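(* Let $d\ge3$ be a fixed integer and let $\varepsilon>0$. There exists $\delta>0$ such that the following holds for all sufficiently large primes $p$. Let $\chi$ be a nonprincipal multiplicative character of ${\mathbb F}_p^*$ (extended by $\chi(0)=0$), let $1\le U,V<p$ be integers with $$U\ge p^{1/d+\varepsilon}\qquad\text{and}\qquad V\ge p^{1/4-\delta},$$ let ${\mathfrak C}\subseteq[1,U]\times[1,V]$ be a convex set, and let $\{\alpha_u\}_{u=1}^U$ be complex numbers with $|\alpha_u|\le1$. Then for every polynomial $f\in{\mathbb F}_p[X]$ of degree $d$, $$\Big|\sum_{(u,v)\in{\mathfrak C}}\alpha_u\,\chi\big(v+f(u)\big)\Big|\le UVp^{-\delta},$$ where the sum is over integer points of ${\mathfrak C}$.
   Context: A polynomial of degree $d$ means exact degree $d$ (nonzero leading coefficient in ${\mathbb F}_p$). The integers $u,v$ are viewed as elements of ${\mathbb F}_p$ via reduction modulo $p$. *)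

(* Defs.v *)
From HB Require Import structures.
From mathcomp Require Import all_boot all_order all_algebra.
From mathcomp Require Import all_classical all_reals all_analysis.
From mathcomp Require Import complex.

Set Implicit Arguments.
Unset Strict Implicit.
Unset Printing Implicit Defensive.

Import Order.TTheory GRing.Theory Num.Theory.

Local Open Scope ring_scope.

(* A group homomorphism F^* -> K^*, extended to F by the value 0 at 0. *)
Definition multiplicative_character (F K : fieldType) (chi : F -> K) : Prop :=
  [/\ chi 0 = 0,
      forall x, x != 0 -> chi x != 0 &
      forall x y, x != 0 -> y != 0 -> chi (x * y) = chi x * chi y].

Definition nonprincipal (F K : fieldType) (chi : F -> K) : Prop :=
  exists2 x : F, x != 0 & chi x != 1.

(* The regular module R^o makes R * R a module over R, as convex_set needs. *)
Definition convex_in_plane (R : realType) (C : set (R * R)) : Prop :=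
  convex_set (C : set (convex_lmodType (R^o * R^o)%type)).

(* For C contained in [1, U] x [1, V], this is the sum over all the integer
   points of C. *)
Definition sum_integer_points (R : realType) (U V : nat) (C : set (R * R))
    (F : nat -> nat -> R[i]) : R[i] :=
  \sum_(1 <= u < U.+1) \sum_(1 <= v < V.+1 | (u%:R, v%:R) \in C) F u v.

(* Main.v *)
(* Split [1, V] into blocks of length about p^(1/4 - delta).  On a block, shifting
   v by a * b bounds the sum over v by averages of |sum_b chi(x + b)|, where
   x = (v + f(u)) / a.  Hoelder's inequality separates the moments of these short
   sums from the number of coincidences (v1 + f(u1)) / a1 = (v2 + f(u2)) / a2.
   - Moments: expanding a 2r-th power reduces to Weil's bound for complete sums of
     chi over products of linear polynomials, one of which occurs once.  The sums
     S_k over F_(p^k) are power sums of the inverse roots of an L-polynomial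
     (Newton's identities), and Stepanov's method gives |S_k| <= c p^(k/2) for even
     k with c independent of k, which forces every inverse root to have modulus at
     most sqrt p.
   - Coincidences: for fixed a1, a2 and u1 the value a1 * f(u2) lies in an interval
     of length O(p^(1/2)) modulo p.  Weyl differencing d times turns this into
     d! c h_1 ... h_d lying in a short interval, c being the leading coefficient;
     since U^d >= p, the divisor bound saves a power of p over the trivial count. *)
From HB Require Import structures.
From mathcomp Require Import all_boot all_order all_algebra all_field.
From mathcomp Require Import zify ring lra complex.
Set Implicit Arguments.
Unset Strict Implicit.
Unset Printing Implicit Defensive.
Import Order.TTheory GRing.Theory Num.Theory.
Local Open Scope ring_scope.

(** * Stepanov's method *)

(** The coincidence count saves [p^(-eta)] with [eta = 1 / (d * 2^d)]: differencing gains
    [p^(-1/d)], of which only a [2^d]-th root survives. Every loss must fit into this saving, which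
    is spent in four quarters: divisor bounds, the factor [p^(1/(2r))] due to the length [B] of the
    short sums, the terms in [delta], and constants. This fixes [r] and [delta]. Long ranges of [v]
    are cut because [A * V0] must stay below [p^(1/2)]: it is the length of the interval in which
    [a1 * f(u2)] has to fall. The exponent [r] is a power of two because Hoelder's inequality is
    obtained by iterating Cauchy-Schwarz. Stepanov's construction needs the square root [q] of the
    field size, hence even degrees; the result is then applied to the squares of the inverse roots.
    It bounds the fibres of the norm from above only, and the vanishing of the sum of [chi] turns
    this into a two-sided estimate. The linear factor that occurs once makes the high coefficients
    of the L-series vanish, whatever the order of [chi]. *)

Lemma linear_system_nontrivial (K : fieldType) (T1 T2 : finType)
    (a : T1 -> T2 -> K) : (#|T2| < #|T1|)%N ->
  exists2 c : T1 -> K, exists x, c x != 0 & forall y, \sum_x c x * a x y = 0.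
Proof.
move=> ltT.
pose A := \matrix_(i < #|T1|, j < #|T2|) a (enum_val i) (enum_val j).
have /matrix0Pn[i' [j' kij]] : kermx A != 0.
  by rewrite kermx_eq0 -row_leq_rank -ltnNge (leq_ltn_trans (rank_leq_col A)).
exists (fun x => kermx A i' (enum_rank x)).
  by exists (enum_val j'); rewrite enum_valK.
move=> y; have := congr1 (fun B : 'M_(_, _) => B i' (enum_rank y)) (mulmx_ker A).
rewrite !mxE => E0; rewrite -[RHS]E0 (reindex (fun k : 'I_#|T1| => enum_val k)) /=; last first.
  by exists enum_rank => x _; rewrite ?enum_rankK ?enum_valK.
by apply: eq_bigr => k _; rewrite enum_valK [A _ _]mxE enum_rankK.
Qed.

Section Taylor.
Variable K : fieldType.
Implicit Types p r g : {poly K}.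

(* In [{poly {poly K}}] the outer variable [Y] is ['X] and the inner one ['X%:P]. *)
Definition taylor p : {poly {poly K}} := (map_poly polyC p) \Po ('X + 'X%:P).

Lemma taylorD p r : taylor (p + r) = taylor p + taylor r.
Proof. by rewrite /taylor rmorphD comp_polyD. Qed.
Lemma taylorM p r : taylor (p * r) = taylor p * taylor r.
Proof. by rewrite /taylor rmorphM comp_polyM. Qed.
Lemma taylorC c : taylor c%:P = c%:P%:P.
Proof. by rewrite /taylor map_polyC comp_polyC. Qed.
Lemma taylorX : taylor 'X = 'X + 'X%:P.
Proof. by rewrite /taylor map_polyX comp_polyX. Qed.
Lemma taylor_exp p n : taylor (p ^+ n) = taylor p ^+ n.
Proof.
elim: n => [|n IH]; first by rewrite !expr0 (taylorC 1).
by rewrite !exprS taylorM IH.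
Qed.
Lemma taylor_sum (I : Type) (s : seq I) (P : pred I) (F : I -> {poly K}) :
  taylor (\sum_(i <- s | P i) F i) = \sum_(i <- s | P i) taylor (F i).
Proof. by apply: (big_morph taylor taylorD); rewrite (taylorC 0). Qed.

Lemma size_coef_taylor p s : (size ((taylor p)`_s)%R <= size p)%N.
Proof.
elim/poly_ind: p s => [|p c IH] s; first by rewrite (taylorC 0) coef0 size_poly0.
rewrite size_MXaddC; case: ifP => [/andP[/eqP-> /eqP->]|nz].
  by rewrite mul0r addr0 (taylorC 0) coef0 size_poly0.
rewrite taylorD taylorM taylorX taylorC mulrDr !coefD coefMX coefMC coefC.
apply: (leq_trans (size_polyD _ _)); rewrite geq_max; apply/andP; split; last first.
  case: ifP => _; last by rewrite size_poly0.
  by apply: (leq_trans (size_polyC_leq1 _)).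
apply: (leq_trans (size_polyD _ _)); rewrite geq_max; apply/andP; split.
  by case: ifP => _; [rewrite size_poly0 | apply: (leq_trans (IH _))].
apply: (leq_trans (size_polyMleq _ _)); rewrite size_polyX addn2 /=.
exact: IH.
Qed.

Lemma taylor_tail g : exists G, taylor g = g%:P + 'X * G.
Proof.
elim/poly_ind: g => [|g c [G HG]].
  by exists 0; rewrite (taylorC 0) mulr0 addr0.
exists (g%:P + G * ('X + 'X%:P)).
rewrite taylorD taylorM taylorX taylorC HG polyCD polyCM; ring.
Qed.

(** Modulo the outer variable [taylor g] is [g], so raising the order [s] by one costs at most one
    factor [g]. The cofactor [A] serves the induction on [N], which absorbs the tail [G] into it. *)
Lemma dvdp_coef_taylor_exp g N s (A : {poly {poly K}}) :
  g ^+ (N - s) %| (A * taylor g ^+ N)`_s.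
Proof.
have [G HG] := taylor_tail g.
elim: N s A => [|N IH] s A; first by rewrite sub0n expr0 dvd1p.
have -> : A * taylor g ^+ N.+1 =
    (A * taylor g ^+ N) * g%:P + 'X * (A * G * taylor g ^+ N).
  rewrite exprS {1}HG; ring.
rewrite coefD coefMC coefXM; apply: dvdp_add.
  case: (leqP s N) => sN; first by rewrite subSn // exprSr dvdp_mul.
  by move/eqP: sN => ->; rewrite expr0 dvd1p.
case: s => [|s] /=; first by rewrite dvdp0.
by rewrite subSS IH.
Qed.

(** The coefficients of [taylor p] are the Hasse derivatives of [p], which detect multiplicities in
    any characteristic: evaluating the inner variable at [t] turns [taylor p] into [p(X + t)]. *)
Lemma XsubC_exp_dvdp_taylor p t l :
  (forall s, (s < l)%N -> ((taylor p)`_s).[t] = 0) -> ('X - t%:P) ^+ l %| p.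
Proof.
move=> H.
have E : map_poly (horner_eval t) (taylor p) = p \Po ('X + t%:P).
  elim/poly_ind: p {H} => [|p c IH].
    by rewrite (taylorC 0) rmorph0 comp_poly0.
  rewrite comp_polyD comp_polyM comp_polyX comp_polyC -IH taylorD taylorM.
  rewrite taylorX taylorC !rmorphD rmorphM /= rmorphD /= map_polyX !map_polyC /=.
  by rewrite /horner_eval hornerX hornerC.
have D : 'X^l %| p \Po ('X + t%:P).
  rewrite -E; apply/dvdpP.
  exists (\poly_(i < size (map_poly (horner_eval t) (taylor p)))
     (map_poly (horner_eval t) (taylor p))`_(i + l)).
  apply/polyP=> i; rewrite coefMXn coef_poly.
  case: ltnP => il; first by rewrite coef_map /= /horner_eval H.
  rewrite subnK //; case: ltnP => // hs.
  by rewrite nth_default //; apply: (leq_trans hs); rewrite leq_subr.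
have := dvdp_comp_poly ('X - t%:P) D.
rewrite -comp_polyA comp_polyD comp_polyX comp_polyC subrK comp_polyXr.
by rewrite rmorphXn /= comp_polyX.
Qed.

End Taylor.

Lemma prod_XsubC_exp_dvdp (K : fieldType) (s : seq K) l (P : {poly K}) :
  uniq s -> (forall t, t \in s -> ('X - t%:P) ^+ l %| P) ->
  \prod_(t <- s) ('X - t%:P) ^+ l %| P.
Proof.
elim: s => [|t s IH] /=; first by rewrite big_nil dvd1p.
move=> /andP[ts us] H; rewrite big_cons Gauss_dvdp.
  rewrite H ?mem_head // IH // => u uS; apply: H; by rewrite inE uS orbT.
apply: coprimep_expl; rewrite coprimep_sym coprimep_XsubC rootE horner_prod.
rewrite (big_morph (fun x => x == 0) (id1 := false) (op1 := orb)); last 2 first.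
- by move=> x y; rewrite mulf_eq0.
- by rewrite oner_eq0.
rewrite big_has; apply/hasPn => u uS; rewrite horner_exp hornerXsubC.
apply: expf_neq0; rewrite subr_eq0; apply: contra ts => /eqP->; exact: uS.
Qed.

Lemma exprD_pchar_pow (R : comNzRingType) p k (x y : R) :
  p \in [pchar R] -> (x + y) ^+ (p ^ k) = x ^+ (p ^ k) + y ^+ (p ^ k).
Proof.
move=> ch; apply: exprDn_pchar; rewrite pnatX; apply/orP; left.
apply/pnatP; first exact: prime_gt0 (pcharf_prime ch).
by move=> r pr; rewrite dvdn_prime2 // ?(pcharf_prime ch) // => /eqP->.
Qed.

(** By additivity of Frobenius, a [p^k]-th power behaves as a constant for Hasse derivatives of
    order below [p^k]. *)
Lemma coef_taylor_mul_pow (K : fieldType) p k (x : {poly K}) i s :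
  p \in [pchar K] -> (s < p ^ k)%N ->
  (taylor (x * 'X^((p ^ k) * i)))`_s = (taylor x)`_s * 'X^((p ^ k) * i).
Proof.
move=> ch sQ; rewrite taylorM taylor_exp taylorX exprM (@exprD_pchar_pow _ p); last by rewrite !pchar_poly.
set y : {poly {poly K}} := 'X%:P ^+ _; set z : {poly {poly K}} := 'X ^+ _.
have [w ->] : exists w, (z + y) ^+ i = ('X ^+ ((p ^ k) * i))%:P + z * w.
  elim: i => [|i [w IH]].
    by exists 0; rewrite !muln0 !expr0 mulr0 addr0.
  exists (('X ^+ ((p ^ k) * i))%:P + w * (z + y)).
  rewrite exprSr IH mulnSr exprD polyCM; have -> : ('X ^+ (p ^ k))%:P = y :> {poly {poly K}}.
    by rewrite /y polyC_exp.
  ring.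
rewrite mulrDr coefD coefMC mulrCA coefXnM sQ addr0; reflexivity.
Qed.

(* Since ['X * g1] has a simple zero at 0 and [(n * M).+1 = Q], the summands have
   pairwise distinct valuations at 0, so the lowest one cannot cancel. *)
Lemma stepanov_combination_neq0 (K : fieldType) (n M b : nat) (g1 : {poly K})
    (c : 'I_b -> 'I_M -> K) : (0 < n)%N -> g1.[0] != 0 ->
  (exists e mu, c e mu != 0) ->
  \sum_e \sum_mu c e mu *: ('X^mu * ('X * g1) ^+ ((e %% n).+1 * M)
      * 'X^((n * M).+1 * (e %/ n))) != 0.
Proof.
move=> n0 g10 [e1 [mu1 c1]].
have ex1 : [exists mu, c e1 mu != 0] by apply/existsP; exists mu1.
case: (@arg_minnP _ e1 (fun e : 'I_b => [exists mu, c e mu != 0]) (fun e => e : nat) ex1).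
move=> e0 /existsP[mu2 c2] min_e0.
case: (@arg_minnP _ mu2 (fun mu => c e0 mu != 0) (fun e => e : nat) c2) => mu0 c0 min_mu0.
(* Valuation at 0 of the summand [e] apart from ['X^mu]. It grows by at least [M] at each step of
   [e], which leaves room for every [mu < M]. *)
pose W (e : nat) := (M * e.+1 + e %/ n)%N.
have termE (e : 'I_b) : \sum_mu c e mu *: ('X^mu * ('X * g1) ^+ ((e %% n).+1 * M)
      * 'X^((n * M).+1 * (e %/ n))) =
    'X^(W e) * (g1 ^+ ((e %% n).+1 * M) * \poly_(i < M) (if insub i is Some mu then c e mu else 0)).
  rewrite poly_def mulrA mulr_sumr; apply: eq_bigr => mu _.
  rewrite insubT // => lt; have -> : Sub (val mu) lt = mu by apply: val_inj.
  rewrite -scalerAr; congr (_ *: _).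
  have -> : W e = ((e %% n).+1 * M + (n * M).+1 * (e %/ n))%N.
    rewrite /W {1}(divn_eq e n); lia.
  rewrite exprMn exprD; ring.
apply/eqP => /(congr1 (fun P : {poly K} => P`_(W e0 + mu0))).
rewrite coef0 coef_sum (bigD1 e0) //= [X in _ + X]big1 => [|e ne]; last first.
  rewrite termE coefXnM; case: ltnP => // le.
  have ee0 : (e < e0)%N.
    rewrite ltn_neqAle (inj_eq val_inj) ne /= leqNgt; apply/negP => lt.
    move: le; rewrite leqNgt => /negP; apply.
    have h : (W e0 + M <= W e)%N.
      rewrite /W; have := leq_div2r n (ltnW lt).
      have : (M * e0.+1 + M <= M * e.+1)%N by rewrite -mulnSr leq_mul2l ltnS lt orbT.
      lia.
    by apply: leq_trans h; rewrite ltn_add2l.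
  have z : forall mu, c e mu = 0.
    move=> mu; apply/eqP/negPn/negP => nz.
    have /min_e0 : [exists mu, c e mu != 0] by apply/existsP; exists mu.
    by rewrite leqNgt ee0.
  rewrite (_ : \poly_(_ < _) _ = 0) ?mulr0 ?coef0 //.
  by apply/polyP => i; rewrite coef_poly coef0; case: ifP => // _; case: insub.
rewrite addr0 termE coefXnM ltnNge leq_addr /= addKn coefM big_ord_recl /= subn0.
rewrite coef_poly ltn_ord insubT // => lt.
have -> : Sub (val mu0) lt = mu0 by apply: val_inj.
rewrite big1 => [|i _]; last first.
  rewrite coef_poly; case: ifP => [h|_]; last by rewrite mulr0.
  rewrite insubT //= (_ : c e0 _ = 0) ?mulr0 //; apply/eqP/negPn/negP => /min_mu0 /=.
  rewrite leqNgt => /negP; apply; have := ltn_ord i; rewrite /bump /=; lia.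
move/eqP; rewrite addr0 -horner_coef0 horner_exp mulf_eq0 (negbTE c0) orbF.
by apply/negP; apply: expf_neq0.
Qed.

(** The auxiliary polynomial has [q * n * M] free coefficients. Vanishing to order [l] on [s] costs
    only [l * d] linear conditions, with [d = q + M + l * m], because [t^(q^2) = t] and [g(t)^M = a]
    replace high powers by low ones. Comparing [l * size s], with [l] close to [n * q], to a degree
    close to [q^3] gives the main term [q^2]. *)
Lemma stepanov_bound (K : fieldType) p k n M m (g1 : {poly K}) (a : K) (s : seq K) :
  let q := (p ^ k)%N in let w := (2 * n ^ 2 * (1 + n * m) + 1)%N in
  p \in [pchar K] -> (0 < n)%N -> ((n * M).+1 = q ^ 2)%N -> (n ^ 2 < q)%N ->
  g1.[0] != 0 -> size ('X * g1) = m.+1 -> a != 0 -> uniq s ->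
  (forall t, t \in s -> t ^+ (q ^ 2) = t /\ ('X * g1).[t] ^+ M = a) ->
  (n * size s <= q ^ 2 + q * (1 + n * m + w))%N.
Proof.
move=> q w ch n0 nM nq g10 sg a0 us Hs.
move gE : ('X * g1) => g in sg Hs *.
have g0 : g != 0 by rewrite -size_poly_eq0 sg.
have sgX N : size (g ^+ N) = (m * N).+1.
  have := size_exp g N; rewrite sg /= => <-; rewrite prednK //.
  by rewrite lt0n size_poly_eq0 expf_neq0.
(* Order [n * q] would impose too many conditions; lowering it by [w] frees [w * M] unknowns, more
   than the excess [l * (q + l * m)]. *)
pose Q := (q ^ 2)%N; pose l := (n * q - w)%N.
have q0 : (0 < q)%N by lia.
have lM : (l <= M)%N.
  have : (n * l <= n * M)%N; last by rewrite leq_pmul2l.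
  have : (n * l <= n * (n * q))%N by rewrite leq_mul2l leq_subr orbT.
  have : (n ^ 2 * q < q ^ 2)%N by rewrite -[(q^2)%N]/(q*q)%N ltn_pmul2r.
  rewrite -nM; lia.
have MQ : (M < Q)%N by rewrite /Q -nM; nia.
(* The successor keeps all these exponents at least [M], hence at least [l], so the subtraction in
   [g^(N e - s)] is never truncated for [s < l]. *)
pose N (e : 'I_(q * n)) := ((e %% n).+1 * M)%N.
have lN e : (l <= N e)%N by rewrite /N mulSn; lia.
have in_ (e : 'I_(q * n)) : (e %/ n < q)%N by rewrite ltn_divLR //; exact: ltn_ord.
pose u (s : nat) (x : 'I_(q * n) * 'I_M) : {poly K} :=
  (taylor ('X^(x.2) * g ^+ N x.1))`_s %/ g ^+ (N x.1 - s).
have uE s0 (x : 'I_(q * n) * 'I_M) : (taylor ('X^(x.2) * g ^+ N x.1))`_s0 = u s0 x * g ^+ (N x.1 - s0).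
  by rewrite /u divpK // taylorM !taylor_exp dvdp_coef_taylor_exp.
have su (s0 : nat) (x : 'I_(q * n) * 'I_M) : (s0 < l)%N -> (size (u s0 x) <= M + l * m)%N.
  move=> sl; rewrite /u size_divp ?expf_neq0 // sgX /=.
  apply: (leq_trans (leq_sub2r _ (size_coef_taylor _ _))).
  rewrite mulrC size_mulXn ?expf_neq0 // sgX.
  rewrite leq_subLR; have /= := ltn_ord x.2; have := lN x.1.
  move: (N _) => N0 h1 h2.
  have : (m * N0 <= m * (N0 - s0) + l * m)%N by rewrite [(l * m)%N]mulnC -mulnDr leq_mul2l; apply/orP; right; lia.
  lia.
(* On the points considered, t^Q = t and g(t)^M = a, so the s-th Hasse derivative
   of the combination vanishes there as soon as that of low degree given by T does. *)
pose T (s : nat) (x : 'I_(q * n) * 'I_M) : {poly K} :=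
  a ^+ (x.1 %% n).+1 *: ('X^(x.1 %/ n) * u s x).
pose d := (q + (M + l * m))%N.
have sT s0 (x : 'I_(q * n) * 'I_M) : (s0 < l)%N -> (size (T s0 x) <= d)%N.
  move=> sl; apply: (leq_trans (size_scale_leq _ _)).
  apply: (leq_trans (size_polyMleq _ _)); rewrite size_polyXn addSn /=.
  by rewrite leq_add ?su // ltnW.
have [] := @linear_system_nontrivial K ('I_(q * n) * 'I_M)%type ('I_l * 'I_d)%type
   (fun x y => (T y.1 x)`_(y.2)).
  rewrite !card_prod !card_ord.
  have [->|l0] := posnP l; first by rewrite mul0n; nia.
  have lE : (l + w = n * q)%N by rewrite subnK //; apply: ltnW; rewrite -subn_gt0.
  suff : (n * (q * (q + l * m)) < w * M)%N.
    rewrite /d => H.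
    have : (l * (q + l * m) <= n * (q * (q + l * m)))%N.
      by rewrite mulnA leq_mul2r; apply/orP; right; lia.
    have : (l * M + w * M = q * n * M)%N by rewrite -mulnDl lE [(n*q)%N]mulnC.
    rewrite mulnDr mulnDr mulnDr in H *; lia.
  have lq : (q + l * m <= q * (1 + n * m))%N.
    have : (l * m <= n * q * m)%N by rewrite leq_mul2r; apply/orP; right; lia.
    nia.
  have : (n * (q * (q + l * m)) <= n * (q * (q * (1 + n * m))))%N.
    by rewrite leq_pmul2l // leq_pmul2l.
  move=> h; apply: (leq_ltn_trans h).
  (* Multiplying by [n] brings in [n * M + 1 = q^2]. The factor 2 in [w] pays for
     [n * M + 1 <= 2 * (n * M)], its final [+ 1] for strictness. *)
  rewrite -(ltn_pmul2l n0) [X in (_ < X)%N]mulnCA.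
  have -> : (n * (n * (q * (q * (1 + n * m)))) = n ^ 2 * (1 + n * m) * (n * M).+1)%N.
    by rewrite nM -!mulnn; lia.
  have Y0 : (0 < n * M)%N by rewrite -ltnS nM; nia.
  rewrite /w -(mulnA 2) mulnDl mul1n; move: (n ^ 2 * (1 + n * m))%N (n * M)%N Y0 => B Y Y0.
  nia.
move=> c [x0 cx0] Hc.
pose P := \sum_e \sum_mu c (e, mu) *: ('X^mu * g ^+ (N e) * 'X^((n * M).+1 * (e %/ n))).
have P0 : P != 0.
  rewrite /P -gE; apply: stepanov_combination_neq0 => //.
  by exists x0.1, x0.2; case: x0 cx0.
have PE : P = \sum_x c x *: ('X^(x.2) * g ^+ (N x.1) * 'X^((n * M).+1 * (x.1 %/ n))).
  by rewrite /P pair_bigA; apply: eq_bigr => -[].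
have dv t : t \in s -> ('X - t%:P) ^+ l %| P.
  move=> ts; have [tQ gt] := Hs t ts.
  have gt0 : g.[t] != 0.
    apply: contra a0 => /eqP z; rewrite -gt z expr0n eqn0Ngt.
    by rewrite (_ : (0 < M)%N) // lt0n; apply/eqP => M0; move: nM nq; rewrite M0; nia.
  apply: XsubC_exp_dvdp_taylor => s0 sl.
  have Z : \sum_x c x *: T s0 x = 0.
    apply/polyP => nu; rewrite coef0 coef_sum; case: (ltnP nu d) => nud.
      rewrite -[RHS](Hc (Ordinal sl, Ordinal nud)).
      by apply: eq_bigr => x _; rewrite coefZ.
    by rewrite big1 // => x _; rewrite coefZ nth_default ?mulr0 // (leq_trans (sT _ _ sl)).
  apply: (mulfI (expf_neq0 s0 gt0)); rewrite mulr0.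
  transitivity ((\sum_x c x *: T s0 x).[t]); last by rewrite Z horner0.
  rewrite PE taylor_sum coef_sum !horner_sum mulr_sumr.
  apply: eq_bigr => x _.
  have -> : (n * M).+1 = (p ^ (k * 2))%N by rewrite nM /q expnM.
  rewrite -mul_polyC taylorM taylorC coefCM coef_taylor_mul_pow //; last first.
    by rewrite expnM -/q; lia.
  rewrite uE hornerM hornerC hornerM hornerM !hornerXn horner_exp hornerZ /T hornerZ hornerM hornerXn.
  have -> : t ^+ (p ^ (k * 2) * (x.1 %/ n)) = t ^+ (x.1 %/ n).
    by rewrite exprM expnM -/q tQ.
  have -> : a ^+ (x.1 %% n).+1 = g.[t] ^+ s0 * g.[t] ^+ (N x.1 - s0).
    rewrite -exprD subnKC; last by have := lN x.1; lia.
    by rewrite /N -gt -exprM; congr (_ ^+ _); apply: mulnC.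
  ring.
have := dvdp_leq P0 (prod_XsubC_exp_dvdp us dv).
have -> : size (\prod_(t <- s) ('X - t%:P) ^+ l) = (l * size s).+1.
  rewrite (eq_bigr (fun t => ('X - t%:P) ^+ l)) // prodrXl.
  have := size_exp (\prod_(t <- s) ('X - t%:P)) l; rewrite size_prod_XsubC /= => E.
  rewrite mulnC -E prednK // lt0n size_poly_eq0 expf_neq0 //.
  by rewrite monic_neq0 // monic_prod_XsubC.
have sP : (size P <= M + n * M * m + Q * q)%N.
  rewrite PE; apply: (leq_trans (size_sum _ _ _)); apply/bigmax_leqP => x _.
  apply: (leq_trans (size_scale_leq _ _)).
  rewrite size_mulXn ?mulf_neq0 ?expf_neq0 ?polyX_eq0 //.
  rewrite mulrC size_mulXn ?expf_neq0 // sgX nM -/Q.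
  have : (Q * (x.1 %/ n) + Q <= Q * q)%N by rewrite -mulnSr leq_mul2l in_ orbT.
  have : (m * N x.1 <= n * M * m)%N.
    by rewrite mulnC leq_mul2r /N leq_mul2r ltn_mod n0 !orbT.
  have := ltn_ord x.2; lia.
have ss : (size s <= Q)%N.
  have sX : size ('X^Q - 'X : {poly K}) = Q.+1.
    by rewrite size_polyDl size_polyXn // size_polyN size_polyX ltnS; nia.
  rewrite -ltnS -sX; apply: max_poly_roots => //; first by rewrite -size_poly_eq0 sX.
  by apply/allP => t /Hs[tQ _]; rewrite rootE !hornerE tQ subrr.
move=> h; have {sP} h := leq_trans h sP.
rewrite -(leq_pmul2r q0).
have : (n * q * size s <= l * size s + w * size s)%N.
  by rewrite -mulnDl leq_mul2r; apply/orP; right; rewrite /l; lia.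
have : (w * size s <= w * Q)%N by rewrite leq_mul2l ss orbT.
have : (n * M * m <= Q * (n * m))%N by rewrite /Q -nM; nia.
rewrite /Q in MQ ss h *. nia.
Qed.

(** * Frobenius orbits *)

Section FrobeniusOrbits.
Variables (p : nat) (p_pr : prime p) (K : closedFieldType).
Variable iota : {rmorphism 'F_p -> K}.

Lemma pchar_extension : p \in [pchar K].
Proof. exact/(rmorph_pchar iota)/pchar_Fp. Qed.

Definition frob (i : nat) (x : K) := x ^+ (p ^ i).

Lemma frobD i x y : frob i (x + y) = frob i x + frob i y.
Proof. exact: exprD_pchar_pow pchar_extension. Qed.
Lemma frobM i x y : frob i (x * y) = frob i x * frob i y.
Proof. exact: exprMn. Qed.
Lemma frob0 i : frob i 0 = 0.
Proof. by rewrite /frob expr0n expn_eq0 eqn0Ngt prime_gt0. Qed.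
Lemma frobN i x : frob i (- x) = - frob i x.
Proof. by apply/eqP; rewrite -addr_eq0 -frobD addNr frob0. Qed.
Lemma frobB i x y : frob i (x - y) = frob i x - frob i y.
Proof. by rewrite frobD frobN. Qed.
Lemma frob_inj i : injective (frob i).
Proof.
move=> x y /eqP; rewrite -subr_eq0 -frobB expf_eq0 => /andP[_].
by rewrite subr_eq0 => /eqP.
Qed.
Lemma frob_add i j x : frob (i + j) x = frob i (frob j x).
Proof. by rewrite /frob -exprM -expnD addnC. Qed.

Lemma frob_iota i a : frob i (iota a) = iota a.
Proof.
have h x : x ^+ p = x :> 'F_p.
  by have := expf_card x; rewrite (card_Fp p_pr).
elim: i => [|i IH]; first by rewrite /frob expr1.
by rewrite -addn1 frob_add /frob expn1 -[iota a ^+ p]rmorphXn h.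
Qed.

Lemma expp_gt1 i : (0 < i)%N -> (1 < p ^ i)%N.
Proof. by move=> i0; rewrite -[1%N](expn0 p) ltn_exp2l // prime_gt1. Qed.

Definition fixpoly i : {poly K} := 'X^(p ^ i) - 'X.

Lemma size_fixpoly i : (0 < i)%N -> size (fixpoly i) = (p ^ i).+1.
Proof.
move=> i0; rewrite size_polyDl size_polyXn // size_polyN size_polyX ltnS.
exact: expp_gt1.
Qed.

Lemma lead_fixpoly i : (0 < i)%N -> lead_coef (fixpoly i) = 1.
Proof.
move=> i0; rewrite lead_coefDl ?lead_coefXn // size_polyXn size_polyN size_polyX ltnS.
exact: expp_gt1.
Qed.

Definition froots i : seq K := sval (closed_field_poly_normal (fixpoly i)).

Lemma fixpolyE i : (0 < i)%N -> fixpoly i = \prod_(z <- froots i) ('X - z%:P).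
Proof.
move=> i0; rewrite /froots; case: closed_field_poly_normal => s /= E.
by rewrite {1}E lead_fixpoly // scale1r.
Qed.

Lemma mem_froots i x : (0 < i)%N -> (x \in froots i) = (frob i x == x).
Proof.
by move=> i0; rewrite -root_prod_XsubC -fixpolyE // rootE !hornerE subr_eq0.
Qed.

Lemma size_froots i : (0 < i)%N -> size (froots i) = (p ^ i)%N.
Proof.
move=> i0; have := size_fixpoly i0; rewrite fixpolyE // size_prod_XsubC.
by case.
Qed.

Lemma uniq_froots i : (0 < i)%N -> uniq (froots i).
Proof.
move=> i0; rewrite -separable_prod_XsubC -fixpolyE // unlock.
rewrite /fixpoly derivB derivXn derivX.
have -> : 'X^((p ^ i).-1) *+ (p ^ i)%N = 0 :> {poly K}.
  rewrite -mulr_natl natrX (_ : p%:R = 0) ?expr0n ?mul0r; last first.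
    by apply: pcharf0; rewrite pchar_poly; exact: pchar_extension.
  by rewrite (gtn_eqF i0) mul0r.
by rewrite sub0r -(scaleN1r (1 : {poly K})) coprimepZr ?coprimep1 // oppr_eq0 oner_eq0.
Qed.

Definition lower (x : K) : 'F_p := odflt 0 [pick a | iota a == x].

Lemma lowerK a : lower (iota a) = a.
Proof.
rewrite /lower; case: pickP => [b /eqP/fmorph_inj //|/(_ a)].
by rewrite eqxx.
Qed.

Lemma iota_lower x : frob 1 x = x -> iota (lower x) = x.
Proof.
move=> fx; suff [a <-] : exists a, iota a = x by rewrite lowerK.
have : x \in froots 1 by rewrite mem_froots // fx.
have us : uniq [seq iota a | a : 'F_p] by rewrite map_inj_uniq ?enum_uniq //; exact: fmorph_inj.
have sub : {subset [seq iota a | a : 'F_p] <= froots 1}.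
  by move=> y /mapP[a _ ->]; rewrite mem_froots // frob_iota.
have /(uniq_min_size us sub)[_ <-] : (size (froots 1) <= size [seq iota a | a : 'F_p])%N.
  by rewrite size_froots // size_map -cardE card_Fp // expn1.
by case/mapP => a _ ->; exists a.
Qed.

Lemma poly_lower (P : {poly K}) : (forall i, frob 1 P`_i = P`_i) ->
  map_poly iota (map_poly lower P) = P.
Proof.
move=> H; apply/polyP => i.
rewrite coef_map /= coef_map_id0 ?iota_lower // -(rmorph0 iota); exact: lowerK.
Qed.

Lemma coef_frob (rs : seq K) i :
  frob 1 (\prod_(r <- rs) ('X - r%:P))`_i =
  (\prod_(r <- [seq frob 1 x | x <- rs]) ('X - r%:P))`_i.
Proof.
elim: rs i => [|r rs IH] i.
  by rewrite !big_nil coef1; case: eqP; rewrite ?frob0 // /frob expr1n.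
rewrite /= !big_cons !mulrBl !coefB !coefXM !coefCM frobB frobM IH.
by case: (i) => [|j]; rewrite /= ?frob0 ?IH.
Qed.

(** Always [k] terms, with repetitions when the period of [t] is a proper divisor of [k]. For [t]
    fixed by [frob k], [orbit_poly] is thus the characteristic polynomial of [t] over the prime
    field in the field of [p^k] elements, a power of the minimal polynomial. *)
Definition orbit_seq k t := mkseq (frob ^~ t) k.
Definition orbit_poly k t := \prod_(x <- orbit_seq k t) ('X - x%:P).

Lemma perm_orbit_seq k t : frob k t = t ->
  perm_eq [seq frob 1 x | x <- orbit_seq k t] (orbit_seq k t).
Proof.
move=> fk; have E : rcons (orbit_seq k t) t = t :: [seq frob 1 x | x <- orbit_seq k t].
  rewrite -[X in rcons _ X]fk -/(orbit_seq _ _) /orbit_seq -mkseqS /mkseq -map_comp /=.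
  rewrite -[1%N]add1n iotaDl -map_comp /frob expr1; congr (_ :: _).
  by apply: eq_map => i; rewrite /= -exprM -expnD addnC.
by rewrite -(perm_cons t) -E perm_rcons.
Qed.

Lemma prod_XsubC_dvdp_count (s rs : seq K) :
  (forall x, x \in s -> count_mem x s <= count_mem x rs)%N ->
  \prod_(x <- s) ('X - x%:P) %| \prod_(x <- rs) ('X - x%:P).
Proof.
elim: s rs => [|x s IH] rs H; first by rewrite big_nil dvd1p.
have xrs : x \in rs.
  by rewrite -has_pred1 has_count; have := H x (mem_head _ _); rewrite /= eqxx; lia.
rewrite big_cons (perm_big _ (perm_to_rem xrs)) big_cons dvdp_mul2l ?polyXsubC_eq0 //.
apply: IH => y ys; have := H y; rewrite inE ys orbT => /(_ isT) /=.
have /permP/(_ (pred1 y)) -> /= := perm_to_rem xrs.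
by rewrite leq_add2l.
Qed.

Lemma count_mem_dvdp (s rs : seq K) x :
  \prod_(x <- s) ('X - x%:P) %| \prod_(x <- rs) ('X - x%:P) ->
  (count_mem x s <= count_mem x rs)%N.
Proof.
move=> D; rewrite -!mu_prod_XsubC mup_geq ?monic_neq0 ?monic_prod_XsubC //.
apply: dvdp_trans D; rewrite -mup_geq //.
by rewrite monic_neq0 ?monic_prod_XsubC.
Qed.

(** As [A] holds at 0, the inner sum is the rank of [k] among the positive elements of [A], so the
    summand selects the first [mu] of them. *)
Lemma sum_rank_leq (A : pred nat) mu N : A 0%N ->
  (\sum_(1 <= k < N.+1) (A k && (\sum_(0 <= i < k) A i <= mu)) =
   minn mu (\sum_(1 <= k < N.+1) A k))%N.
Proof.
move=> A0; elim: N => [|N IH]; first by rewrite !big_nil minn0.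
rewrite [in LHS]big_nat_recr //= [in RHS]big_nat_recr //= IH.
rewrite (big_ltn (ltn0Sn N)) A0; move: (\sum_(1 <= _ < _) _)%N => S.
by case: (A N.+1) => /=; case: leqP; lia.
Qed.

Section RootMultiplicity.
Variables (h : {poly 'F_p}) (rs : seq K).
Hypothesis hE : map_poly iota h = \prod_(r <- rs) ('X - r%:P).

Lemma count_mem_frob i x : count_mem (frob i x) rs = count_mem x rs.
Proof.
elim: i => [|i IH]; first by rewrite /frob expr1.
rewrite -add1n frob_add -IH; move: (frob i x) => {IH}y.
have P : perm_eq [seq frob 1 r | r <- rs] rs.
  apply: prod_XsubC_eq; apply/polyP => j.
  by rewrite -coef_frob -hE coef_map frob_iota.
have /permP/(_ (pred1 (frob 1 y))) <- := P.
by rewrite count_map; apply: eq_count => z /=; rewrite (inj_eq (@frob_inj 1)).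
Qed.

Lemma count_mem_orbit_seq k i t : frob k t = t ->
  count_mem (frob i t) (orbit_seq k t) = count_mem t (orbit_seq k t).
Proof.
move=> fk; elim: i => [|i IH]; first by rewrite /frob expr1.
rewrite -add1n frob_add -IH; move: (frob i t) => {IH}y.
have /permP/(_ (pred1 (frob 1 y))) <- := perm_orbit_seq fk.
by rewrite count_map; apply: eq_count => z /=; rewrite (inj_eq (@frob_inj 1)).
Qed.

(** Both multiplicities are constant along the Frobenius orbit, so comparing them at [t] is
    enough. *)
Lemma orbit_poly_dvdp k t : frob k t = t ->
  (orbit_poly k t %| map_poly iota h)%R = (count_mem t (orbit_seq k t) <= count_mem t rs)%N.
Proof.
move=> fk; rewrite hE; apply/idP/idP; first exact: count_mem_dvdp.
move=> le; apply: prod_XsubC_dvdp_count => x /mapP[i _ ->].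
by rewrite count_mem_orbit_seq // count_mem_frob.
Qed.

Lemma frob_period t : t \in rs -> exists2 e, (0 < e)%N & frob e t = t.
Proof.
move=> trs; have inr i : frob i t \in rs.
  by rewrite -has_pred1 has_count count_mem_frob -has_count has_pred1.
have : ~~ uniq (orbit_seq (size rs).+1 t).
  apply/negP => u; have := uniq_leq_size u (s2 := rs).
  rewrite size_mkseq ltnn => F; apply: notF; apply: F => x /mapP[i _ ->]; exact: inr.
case/(uniqPn 0) => i [j]; rewrite size_mkseq => -[ij jn].
rewrite !nth_mkseq ?(ltn_trans ij) // => E.
exists (j - i)%N; first by rewrite subn_gt0.
apply: (@frob_inj i); rewrite -frob_add subnKC ?E //; exact: ltnW.
Qed.

(** Let [e] be the period of [t] and [mu] its multiplicity. The relevant [k] are the multiples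
    [e * j]; there [t] occurs [j] times in its orbit list, and divisibility means [j <= mu]. *)
Lemma sum_orbit_poly_dvdp_root t : t \in rs ->
  (\sum_(1 <= k < (size rs).+1)
     ((frob k t == t)%R && (orbit_poly k t %| map_poly iota h)%R) = count_mem t rs)%N.
Proof.
move=> trs; set n := size rs; set mu := count_mem t rs.
have [e e0 fe] := frob_period trs.
(* Beyond the degree of [h] no orbit polynomial divides it, so the range may be extended to reach
   [e * mu]. *)
pose N := maxn n (e * mu).
have -> : (\sum_(1 <= k < n.+1) ((frob k t == t)%R && (orbit_poly k t %| map_poly iota h)%R) =
  \sum_(1 <= k < N.+1) ((frob k t == t)%R && (orbit_poly k t %| map_poly iota h)%R))%N.
  rewrite [in RHS](@big_cat_nat _ _ _ n.+1) //= ?ltnS ?leq_maxl //.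
  rewrite [X in (_ + X)%N]big_nat_cond [X in (_ + X)%N]big1 ?addn0 // => k /andP[/andP[nk _] _].
  case: (boolP (orbit_poly _ _ %| _)); rewrite ?andbF // => /dvdp_leq.
  rewrite hE monic_neq0 ?monic_prod_XsubC // => /(_ isT).
  by rewrite !size_prod_XsubC size_mkseq ltnS leqNgt nk.
pose A k := frob k t == t.
have A0 : A 0%N by rewrite /A /frob expr1 eqxx.
transitivity (\sum_(1 <= k < N.+1) (A k && (\sum_(0 <= i < k) A i <= mu)))%N.
  apply: eq_bigr => k _; rewrite /A; case: eqP => //= fk.
  rewrite orbit_poly_dvdp // /orbit_seq /mkseq count_map -sum1_count.
  by rewrite /index_iota subn0 big_mkcond.
rewrite sum_rank_leq //; apply/minn_idPl.
have Am j : A (e * j)%N.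
  elim: j => [|j IH]; first by rewrite muln0.
  by rewrite /A mulnS frob_add (eqP IH) fe.
suff H : (mu <= \sum_(1 <= k < (e * mu).+1) A k)%N.
  apply: leq_trans H _; rewrite [in leqRHS](@big_cat_nat _ _ _ (e * mu).+1) //= ?leq_addr //.
  by rewrite ltnS leq_maxr.
elim: (mu) => // j IH; rewrite (@big_cat_nat _ _ _ (e * j).+1) //=; last by rewrite ltnS leq_mul2l leqnSn orbT.
rewrite -[leqLHS]addn1; apply: leq_add => //.
by rewrite big_nat_recr ?ltn_mul2l ?e0 ?ltnSn //= Am leq_addl.
Qed.

Lemma sum_orbit_poly_dvdp :
  (\sum_(1 <= k < (size rs).+1) \sum_(t <- froots k) (orbit_poly k t %| map_poly iota h)%R =
   size rs)%N.
Proof.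
transitivity (\sum_(t <- undup rs) count_mem t rs)%N; last first.
  under eq_bigr do rewrite -sum1_count big_mkcond /=.
  rewrite exchange_big /= -sum1_size [in LHS]big_seq [in RHS]big_seq.
  apply: eq_bigr => y yrs; transitivity (count_mem y (undup rs)).
    by rewrite -sum1_count [in RHS]big_mkcond /=; apply: eq_bigr => z _; rewrite eq_sym.
  by rewrite count_uniq_mem ?undup_uniq // mem_undup yrs.
transitivity (\sum_(1 <= k < (size rs).+1) \sum_(t <- undup rs)
     ((frob k t == t)%R && (orbit_poly k t %| map_poly iota h)%R))%N; last first.
  rewrite exchange_big /= [in LHS]big_seq [in RHS]big_seq; apply: eq_bigr => t.
  by rewrite mem_undup => /sum_orbit_poly_dvdp_root.
apply: eq_big_nat => k /andP[k0 _].
have sE (P : pred K) s : (\sum_(t <- s) P t)%N = size (filter P s).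
  by rewrite size_filter -sum1_count [in RHS]big_mkcond.
rewrite !sE; apply/perm_size/uniq_perm; rewrite ?filter_uniq ?undup_uniq ?uniq_froots //.
move=> t; rewrite !mem_filter mem_froots // mem_undup andbC -andbA.
congr (_ && _); case: (boolP (_ %| _)) => //= D; apply/esym.
rewrite -root_prod_XsubC -hE; apply: root_dvdp; first exact: D.
rewrite /orbit_poly root_prod_XsubC; apply/mapP; exists 0%N; first by rewrite mem_iota.
by rewrite /frob expr1.
Qed.

End RootMultiplicity.

Definition descend k t : {poly 'F_p} := map_poly lower (orbit_poly k t).

Lemma map_descend k t : frob k t = t -> map_poly iota (descend k t) = orbit_poly k t.
Proof.
move=> fk; apply: poly_lower => i; rewrite coef_frob.
by rewrite (perm_big _ (perm_orbit_seq fk)).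
Qed.

Lemma descend_monic k t : frob k t = t -> descend k t \is monic.
Proof. by move=> fk; rewrite -(map_monic iota) map_descend // monic_prod_XsubC. Qed.

Lemma size_descend k t : frob k t = t -> size (descend k t) = k.+1.
Proof.
by move=> fk; rewrite -(size_map_poly iota) map_descend // size_prod_XsubC size_mkseq.
Qed.

(** Polynomial analogue of writing log n as the sum of the von Mangoldt function over the divisors
    of n, prime powers being counted through their roots. It is unique factorization in logarithmic
    form. *)
Lemma sum_descend_dvdp (h : {poly 'F_p}) n : h \is monic -> size h = n.+1 ->
  (\sum_(1 <= k < n.+1) \sum_(t <- froots k) (descend k t %| h)%R = n)%N.
Proof.
move=> hm hs; have [rs hE] := closed_field_poly_normal (map_poly iota h).
rewrite lead_coef_map (monicP hm) rmorph1 scale1r in hE.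
have ns : size rs = n.
  by have := hs; rewrite -(size_map_poly iota) hE size_prod_XsubC => -[].
have := sum_orbit_poly_dvdp hE; rewrite ns => E; rewrite -[RHS]E.
apply: eq_big_nat => k /andP[k0 _]; rewrite [in LHS]big_seq [in RHS]big_seq.
apply: eq_bigr => t; rewrite mem_froots // => /eqP fk.
by rewrite -map_descend // dvdp_map.
Qed.

End FrobeniusOrbits.

(** * L-polynomials and the Weil bound *)

Section MonicPolynomials.
Variable F : finFieldType.

(** The vector of lower coefficients provides a finite type over which to sum monic polynomials of a
    given degree. *)
Definition monic_of n (v : 'rV[F]_n) : {poly F} := 'X^n + rVpoly v.

Lemma size_rVpoly_lt n (v : 'rV[F]_n) : (size (rVpoly v) < n.+1)%N.
Proof. by rewrite ltnS size_poly. Qed.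

Lemma size_monic_of n (v : 'rV[F]_n) : size (monic_of v) = n.+1.
Proof. by rewrite size_polyDl size_polyXn // size_rVpoly_lt. Qed.

Lemma monic_of_monic n (v : 'rV[F]_n) : monic_of v \is monic.
Proof. by rewrite monicE lead_coefDl ?lead_coefXn // size_polyXn size_rVpoly_lt. Qed.

Lemma size_monic_sub n (h : {poly F}) : h \is monic -> size h = n.+1 ->
  (size (h - 'X^n)%R <= n)%N.
Proof.
move=> hm hs; apply/leq_sizeP => j; rewrite leq_eqVlt coefB coefXn.
case/orP => [/eqP <-|nj]; last by rewrite nth_default ?hs // gtn_eqF // subrr.
by rewrite eqxx; move/monicP: hm; rewrite /lead_coef hs => ->; rewrite subrr.
Qed.

Lemma monic_of_poly_rV n (h : {poly F}) : h \is monic -> size h = n.+1 ->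
  monic_of (poly_rV (h - 'X^n) : 'rV_n) = h.
Proof. by move=> hm hs; rewrite /monic_of poly_rV_K ?size_monic_sub // addrC subrK. Qed.

Lemma monic_ofK n (v : 'rV[F]_n) : poly_rV (monic_of v - 'X^n) = v.
Proof. by rewrite /monic_of addrC addKr rVpolyK. Qed.
End MonicPolynomials.

(* Coefficients of [\prod_(w <- ws) (1 - w * 'X)]. *)
Fixpoint signed_esf (C : nzRingType) (ws : seq C) (n : nat) : C :=
  if ws is w :: ws' then
    signed_esf ws' n - (if n is n'.+1 then w * signed_esf ws' n' else 0)
  else (n == 0%N)%:R.

Lemma coef_prod_signed_esf (C : comNzRingType) (ws : seq C) n :
  (\prod_(w <- ws) (1 - w *: 'X))`_n = signed_esf ws n.
Proof.
elim: ws n => [|w ws IH] n; first by rewrite big_nil coef1.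
rewrite big_cons mulrBl mul1r coefB -scalerAl coefZ coefXM IH /=.
by case: n => [|n] /=; rewrite ?mulr0 ?IH.
Qed.

Lemma signed_esf0 (C : nzRingType) (ws : seq C) : signed_esf ws 0 = 1.
Proof. by elim: ws => //= w ws ->; rewrite subr0. Qed.

(** Logarithmic derivative of the product of the [1 - w * X], read coefficientwise. As
    [signed_esf ws 0 = 1], it determines the power sums from the coefficients without division. *)
Lemma newton_signed_esf (C : comNzRingType) (ws : seq C) n :
  n%:R * signed_esf ws n =
    - \sum_(0 <= k < n) (\sum_(w <- ws) w ^+ k.+1) * signed_esf ws (n - k.+1).
Proof.
elim: ws n => [|w ws IH] n.
  rewrite big1 => [|k _]; last by rewrite big_nil mul0r.
  by rewrite oppr0; case: n => [|n]; rewrite /= ?mul0r ?mulr0.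
case: n => [|n]; first by rewrite big_geq // oppr0 mul0r.
under eq_bigr do rewrite big_cons mulrDl.
rewrite big_split /=.
have -> : \sum_(0 <= k < n.+1) w ^+ k.+1 * (signed_esf ws (n.+1 - k.+1)
    - (if (n.+1 - k.+1)%N is n'.+1 then w * signed_esf ws n' else 0)) = w * signed_esf ws n.
  (* The summand is [G k.+1 - G k], [G n.+1] vanishes, and only the boundary term at 0 survives. *)
  pose G k := - (if (n.+1 - k)%N is n'.+1 then w ^+ k.+1 * signed_esf ws n' else 0).
  rewrite (eq_big_nat _ _ (F2 := fun k => G k.+1 - G k)) => [|k /andP[_ kn]].
    rewrite telescope_sumr // /G subnn subn0 expr1; ring.
  rewrite /G subSS (_ : (n.+1 - k = (n - k).+1)%N) ?subSn //.
  by case: (n - k)%N => [|j]; rewrite ?subr0 ?oppr0 ?sub0r ?opprK // !exprS; ring.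
have -> : \sum_(0 <= k < n.+1) (\sum_(j <- ws) j ^+ k.+1) * (signed_esf ws (n.+1 - k.+1)
    - (if (n.+1 - k.+1)%N is n'.+1 then w * signed_esf ws n' else 0)) =
  - (n.+1%:R * signed_esf ws n.+1) + w * (n%:R * signed_esf ws n).
  rewrite !IH opprK mulrN mulr_sumr big_nat_recr // [in RHS]big_nat_recr //=.
  rewrite !subnn subr0 addrAC; congr (_ + _).
  rewrite -sumrB; apply: eq_big_nat => k /andP[_ kn].
  rewrite subSS (_ : (n - k = (n - k.+1).+1)%N); last by lia.
  ring.
by rewrite -natr1; ring.
Qed.

Lemma factor_unit_constant (C : closedFieldType) (P : {poly C}) : P`_0 = 1 ->
  exists2 ws : seq C, ((size ws).+1 <= size P)%N & forall n, P`_n = signed_esf ws n.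
Proof.
move=> P0; have [zs E] := closed_field_poly_normal P.
have Pn0 : P != 0 by apply/eqP => z; move/eqP: P0; rewrite z coef0 eq_sym oner_eq0.
have zn0 z : z \in zs -> z != 0.
  move=> zz; apply/eqP => z0; have : root P 0.
    by rewrite E rootZ ?lead_coef_eq0 // root_prod_XsubC -z0.
  by rewrite /root horner_coef0 P0 oner_eq0.
exists [seq z^-1 | z <- zs].
  by rewrite size_map E size_scale ?lead_coef_eq0 // size_prod_XsubC.
move=> n; rewrite -coef_prod_signed_esf; congr (_`_n).
set c := lead_coef P in E.
have {}E : P = (c * \prod_(z <- zs) (- z)) *: \prod_(w <- [seq z^-1 | z <- zs]) (1 - w *: 'X).
  rewrite {1}E big_map -scalerA; congr (_ *: _).
  elim: zs zn0 {E} => [|z zs IH] zn0; first by rewrite !big_nil scale1r.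
  rewrite !big_cons IH => [|y yz]; last by apply: zn0; rewrite inE yz orbT.
  rewrite -!mul_polyC polyCM !rmorphN /=.
  have zE : z%:P * z^-1%:P = 1 :> {poly C} by rewrite -polyCM divff // zn0 ?mem_head.
  rewrite -[X in X * _ = _](_ : (- z%:P) * (1 - z^-1%:P * 'X) = _); first by ring.
  by rewrite mulrBr mulr1 mulNr mulrA zE mul1r opprK addrC.
have := P0; rewrite {1}E coefZ coef_prod_signed_esf signed_esf0 mulr1 => c1.
by rewrite {1}E c1 scale1r.
Qed.

(** If [|z0| > P], isolating [z0] by a fixed combination of shifted power sums would keep
    [(|z0| / P)^k] bounded, against Bernoulli's inequality and the Archimedean property. The
    threshold [k0] leaves room for Stepanov's condition that [q] be large. *)
Lemma power_sum_root_bound (C : numClosedFieldType) (zs : seq C) (c P : C) k0 :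
  (forall x : C, exists n : nat, `|x| < n%:R) -> 0 < P -> 0 <= c ->
  (forall k, (k0 <= k)%N -> `|\sum_(z <- zs) z ^+ k| <= c * P ^+ k) ->
  forall z, z \in zs -> `|z| <= P.
Proof.
move=> archi P0 c0 H z0 z0s.
(* [phi] isolates [z0] among the values of [zs], as in Lagrange interpolation. *)
pose phi := \prod_(z <- undup zs | z != z0) ('X - z%:P).
have phi0 : phi.[z0] != 0.
  rewrite /phi horner_prod prodf_seq_neq0; apply/allP => z _; apply/implyP => zz.
  by rewrite hornerXsubC subr_eq0 eq_sym.
have phiz z : z \in zs -> z != z0 -> phi.[z] = 0.
  move=> zz nz; apply/eqP; rewrite -/(root _ _) /phi -big_filter root_prod_XsubC.
  by rewrite mem_filter nz mem_undup.
pose B := \sum_(j < size phi) `|phi`_j| * (c * P ^+ j).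
have key k : (k0 <= k)%N -> `|z0| ^+ k * `|phi.[z0]| <= B * P ^+ k.
  move=> kk.
  have E : \sum_(z <- zs) z ^+ k * phi.[z] = (z0 ^+ k * phi.[z0]) *+ count_mem z0 zs.
    rewrite big_seq (bigID (pred1 z0)) /= [X in _ + X]big1 => [|z /andP[zz nz]].
      rewrite addr0 (eq_bigr (fun=> z0 ^+ k * phi.[z0])); last by move=> z /andP[_ /eqP ->].
      rewrite big_const_seq iter_addr_0; congr (_ *+ _).
      by apply: eq_in_count => z zz; rewrite /= zz.
    by rewrite phiz // mulr0.
  have cnt : (0 < count_mem z0 zs)%N by rewrite -has_count has_pred1.
  apply: (@le_trans _ _ `|\sum_(z <- zs) z ^+ k * phi.[z]|).
    rewrite E normrMn normrM normrX; case: (count_mem z0 zs) cnt => // j _.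
    by rewrite mulrS lerDl mulrn_wge0 // mulr_ge0 ?exprn_ge0.
  have -> : \sum_(z <- zs) z ^+ k * phi.[z] =
      \sum_(j < size phi) phi`_j * \sum_(z <- zs) z ^+ (k + j).
    under [RHS]eq_bigr do rewrite mulr_sumr.
    rewrite exchange_big /=; apply: eq_bigr => z _.
    rewrite horner_coef mulr_sumr; apply: eq_bigr => j _; rewrite exprD; ring.
  apply: (le_trans (ler_norm_sum _ _ _)); rewrite /B mulr_suml.
  apply: ler_sum => j _; rewrite normrM -!mulrA -exprD addnC ler_wpM2l //.
  by apply: H; rewrite (leq_trans kk) // leq_addl.
rewrite real_leNgt ?normr_real ?gtr0_real //; apply/negP => lt.
pose x := `|z0| / P; have x1 : 1 < x by rewrite ltr_pdivlMr // mul1r.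
have bern k : 1 + k%:R * (x - 1) <= x ^+ k.
  elim: k => [|k IH]; first by rewrite mul0r addr0.
  have x0 : 0 <= x - 1 by rewrite subr_ge0 ltW.
  rewrite exprS; apply: (@le_trans _ _ (x * (1 + k%:R * (x - 1)))); last first.
    by rewrite ler_wpM2l // (le_trans ler01) // ltW.
  rewrite -subr_ge0 (_ : _ - _ = k%:R * (x - 1) ^+ 2); last by rewrite -natr1; ring.
  by rewrite mulr_ge0 // exprn_ge0.
pose D := B / `|phi.[z0]|.
have key2 k : (k0 <= k)%N -> x ^+ k <= D.
  move=> /key; rewrite /x /D expr_div_n ler_pdivrMr ?exprn_gt0 // mulrAC.
  by rewrite ler_pdivlMr ?normr_gt0.
have [n nD] := archi (D / (x - 1)).
have D0 : 0 <= D by rewrite (le_trans _ (key2 k0 _)) // exprn_ge0 // ltW // (lt_trans ltr01).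
have := le_trans (bern (n + k0)%N) (key2 _ (leq_addl _ _)).
apply/negP; rewrite -real_ltNge ?ger0_real //; last first.
  by rewrite addr_ge0 // mulr_ge0 // subr_ge0 ltW.
have : D < n%:R * (x - 1).
  rewrite -ltr_pdivrMr ?subr_gt0 //; apply: le_lt_trans nD.
  by rewrite ger0_norm // divr_ge0 // subr_ge0 ltW.
move=> h; apply: (lt_le_trans h); rewrite -[leLHS]add0r lerD //.
apply: ler_wpM2r; last by rewrite ler_nat leq_addr.
by rewrite subr_ge0 ltW.
Qed.

Section CharacterSums.
Variables (F : finFieldType) (C : numClosedFieldType) (chi : F -> C).
Hypotheses (chi0 : chi 0 = 0) (chi1 : chi 1 = 1).
Hypothesis chiM : forall x y, chi (x * y) = chi x * chi y.

Lemma chi_prod (I : Type) (s : seq I) (P : pred I) (f : I -> F) :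
  chi (\prod_(i <- s | P i) f i) = \prod_(i <- s | P i) chi (f i).
Proof. exact: (big_morph chi chiM chi1). Qed.

Lemma chiX x n : chi (x ^+ n) = chi x ^+ n.
Proof. by elim: n => [|n IH]; rewrite ?expr0 // !exprS chiM IH. Qed.

Lemma norm_chi x : x != 0 -> `|chi x| = 1.
Proof.
move=> x0; have F1 : (0 < #|F|.-1)%N by rewrite -ltnS prednK ?finNzRing_gt1 // (ltn_trans _ (finNzRing_gt1 F)).
have E : x ^+ #|F|.-1 = 1.
  apply: (mulfI x0); rewrite -exprS prednK ?expf_card ?mulr1 //.
  exact: ltn_trans (finNzRing_gt1 F).
apply/eqP; rewrite -(@pexpr_eq1 _ _ #|F|.-1) // -normrX -chiX E chi1 normr1 eqxx //.
Qed.

Lemma norm_chi_le1 x : `|chi x| <= 1.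
Proof.
by case: (eqVneq x 0) => [->|x0]; [rewrite chi0 normr0 ler01 | rewrite norm_chi].
Qed.

Lemma sum_chi : (exists2 x, x != 0 & chi x != 1) -> \sum_x chi x = 0.
Proof.
case=> y y0 cy; apply/eqP; have : chi y * \sum_x chi x = \sum_x chi x.
  rewrite mulr_sumr [RHS](reindex (fun x => y * x)) /=; last first.
    by exists (fun x => y^-1 * x) => x _; rewrite ?mulKf ?mulVKf.
  by apply: eq_bigr => x _; rewrite chiM.
move/eqP; rewrite -subr_eq0 -{2}[\sum_x _]mul1r -mulrBl mulf_eq0 subr_eq0.
by rewrite (negbTE cy).
Qed.

Section LFunction.
Variable bs : seq F.

(** Completely multiplicative in [h]. On [X + t] it is the summand of the sum to be bounded;
    repetitions in [bs] encode exponents. *)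
Definition chi_poly (h : {poly F}) : C := chi (\prod_(b <- bs) h.[b]).

Lemma chi_polyM h1 h2 : chi_poly (h1 * h2) = chi_poly h1 * chi_poly h2.
Proof.
rewrite /chi_poly -chiM -big_split; congr (chi _).
by apply: eq_bigr => b _; rewrite hornerM.
Qed.

(** Coefficient of [T^n] in the L-series of the multiplicative function [chi_poly]. *)
Definition lcoef n : C := \sum_(v : 'rV[F]_n) chi_poly (monic_of v).

Lemma rV0_eq (v w : 'rV[F]_0) : v = w.
Proof. by apply/rowP => -[]. Qed.

Lemma lcoef0 : lcoef 0 = 1.
Proof.
rewrite /lcoef (big_pred1 0) => [|v]; last by rewrite (rV0_eq v 0) /= eqxx.
rewrite /chi_poly (_ : monic_of _ = 1) ?big1 // => [b _|]; first by rewrite hornerC.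
by rewrite /monic_of raddf0 addr0.
Qed.

Lemma lcoef1 : lcoef 1 = \sum_t chi (\prod_(b <- bs) (t + b)).
Proof.
rewrite /lcoef (reindex (fun t => const_mx t : 'rV[F]_1)) /=; last first.
  exists (fun v => v 0 0) => [t _|v _]; first by rewrite mxE.
  by apply/rowP => i; rewrite mxE !ord1.
apply: eq_bigr => t _; rewrite /chi_poly; congr (chi _); apply: eq_bigr => b _.
rewrite /monic_of; have -> : rVpoly (const_mx t : 'rV[F]_1) = t%:P.
  apply/polyP => i; rewrite coef_rVpoly coefC; case: insubP => [j _ <-|].
    by rewrite mxE ord1.
  by case: i.
by rewrite hornerD hornerC hornerXn expr1 addrC.
Qed.

Lemma sum_dvdp_chi_poly (d : {poly F}) k n : d \is monic -> size d = k.+1 -> (k <= n)%N ->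
  \sum_(v : 'rV[F]_n | d %| monic_of v) chi_poly (monic_of v) = chi_poly d * lcoef (n - k).
Proof.
move=> dm ds kn; rewrite /lcoef mulr_sumr.
have d0 : d != 0 by rewrite monic_neq0.
have mm (w : 'rV[F]_(n - k)) : d * monic_of w \is monic /\ size (d * monic_of w) = n.+1.
  split; first by rewrite monicMl // monic_of_monic.
  by rewrite size_Mmonic // ?monic_of_monic // ds size_monic_of addnS /= addSn subnKC.
have qm (v : 'rV[F]_n) : d %| monic_of v ->
    (monic_of v %/ d \is monic) /\ size (monic_of v %/ d) = (n - k).+1.
  move=> D; split; last first.
    by rewrite size_divp // ds size_monic_of /= subSn.
  by rewrite -(monicMr _ dm) divpK // monic_of_monic.
rewrite (reindex_onto (fun w : 'rV[F]_(n - k) => poly_rV (d * monic_of w - 'X^n) : 'rV_n)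
   (fun v => poly_rV (monic_of v %/ d - 'X^(n - k)))) /=; last first.
  move=> v /[dup] D /qm[m1 m2]; rewrite monic_of_poly_rV // mulrC divpK //.
  by rewrite monic_ofK.
apply: eq_big => [w|w _]; last by rewrite monic_of_poly_rV ?chi_polyM //; case: (mm w).
have [m1 m2] := mm w; rewrite monic_of_poly_rV // dvdp_mulr //=.
by rewrite mulKp // monic_ofK eqxx.
Qed.

(* Adding a multiple of [G] rescales the value at [a] and fixes the values at
   the other points of [bs]. *)
Lemma lcoef_eq0 a cs n : bs = a :: cs -> a \notin cs ->
  (exists2 x, x != 0 & chi x != 1) -> (size (undup cs) < n)%N -> lcoef n = 0.
Proof.
move=> bsE acs [lam lam0 clam] sn.
pose G := \prod_(b <- undup cs) ('X - b%:P).
have sG : (size G <= n)%N by rewrite size_prod_XsubC.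
have Ga : G.[a] != 0 by rewrite -/(root G a) root_prod_XsubC mem_undup.
have Gb b : b \in cs -> G.[b] = 0.
  by move=> bc; apply/eqP; rewrite -/(root G b) root_prod_XsubC mem_undup.
pose phi l (v : 'rV[F]_n) := v + poly_rV (((l - 1) * (monic_of v).[a] / G.[a]) *: G).
have phiE l v : monic_of (phi l v) = monic_of v + ((l - 1) * (monic_of v).[a] / G.[a]) *: G.
  rewrite /monic_of /phi raddfD /= poly_rV_K ?addrA //.
  exact: leq_trans (size_scale_leq _ _) sG.
have phia l v : (monic_of (phi l v)).[a] = l * (monic_of v).[a].
  by rewrite phiE hornerD hornerZ divfK //; ring.
have phiK l : l != 0 -> cancel (phi l) (phi l^-1).
  move=> l0 v; rewrite {1}/phi phia /phi -addrA -raddfD -scalerDl /=.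
  rewrite (_ : (l - 1) * _ / _ + _ = 0) ?scale0r ?raddf0 ?addr0 //.
  by field; rewrite l0 Ga.
apply/eqP; have : chi lam * lcoef n = lcoef n.
  rewrite mulr_sumr [RHS](reindex (phi lam)) /=; last first.
    exists (phi lam^-1) => w _; first exact: phiK.
    by rewrite -{1}(invrK lam) phiK ?invr_eq0.
  apply: eq_bigr => v _; rewrite /chi_poly -chiM bsE !big_cons phia mulrA.
  congr (chi (_ * _)); rewrite [LHS]big_seq [RHS]big_seq; apply: eq_bigr => b bc.
  by rewrite phiE hornerD hornerZ (Gb _ bc) mulr0 addr0.
move/eqP; rewrite -subr_eq0 -{2}[lcoef n]mul1r -mulrBl mulf_eq0 subr_eq0.
by rewrite (negbTE clam).
Qed.
End LFunction.
End CharacterSums.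

Section WeilBound.
Variables (p : nat) (p_pr : prime p) (K : closedFieldType).
Variable iota : {rmorphism 'F_p -> K}.
Variables (C : numClosedFieldType) (chi : 'F_p -> C).
Hypotheses (chi0 : chi 0 = 0) (chi1 : chi 1 = 1).
Hypothesis chiM : forall x y, chi (x * y) = chi x * chi y.
Hypothesis chi_np : exists2 x, x != 0 & chi x != 1.
Variable cs : seq 'F_p.
Hypothesis cs0 : 0 \notin cs.
Let bs := 0 :: cs.

(** The sum S_k of the overview: its summand is [chi] of the norm, from the field of [p^k] elements,
    of the product of the [b - t]. *)
Definition power_sum k : C := \sum_(t <- froots p K k) chi_poly chi bs (descend iota k t).

(** Logarithmic derivative of the Euler product: for each monic polynomial the factor [n] is
    replaced by the count in [sum_descend_dvdp], and after exchanging sums the multiples of each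
    [descend iota k t] are summed by multiplicativity. *)
Lemma newton_lcoef n :
  n%:R * lcoef chi bs n = \sum_(0 <= k < n) power_sum k.+1 * lcoef chi bs (n - k.+1).
Proof.
transitivity (\sum_(1 <= k < n.+1) \sum_(t <- froots p K k)
   \sum_(v : 'rV['F_p]_n | descend iota k t %| monic_of v) chi_poly chi bs (monic_of v)).
  rewrite /lcoef mulr_sumr.
  under [RHS]eq_bigr => k _ do (under eq_bigr => t _ do rewrite big_mkcond /=).
  under [RHS]eq_bigr => k _ do rewrite exchange_big /=.
  rewrite exchange_big /=; apply: eq_bigr => v _.
  rewrite -[X in X%:R * _](sum_descend_dvdp p_pr iota (monic_of_monic v) (size_monic_of v)).
  rewrite natr_sum mulr_suml; apply: eq_bigr => k _.
  rewrite natr_sum mulr_suml; apply: eq_bigr => t _.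
  by case: (_ %| _); rewrite ?mul1r ?mul0r.
rewrite big_add1 /=; apply: eq_big_nat => k /andP[_ kn].
rewrite /power_sum mulr_suml [LHS]big_seq [RHS]big_seq; apply: eq_bigr => t.
rewrite mem_froots // => /eqP ft.
by rewrite (@sum_dvdp_chi_poly _ _ _ chiM bs _ k.+1) ?size_descend ?descend_monic.
Qed.

Definition char_poly_at : {poly K} := \prod_(b <- bs) ((iota b)%:P - 'X).

(** At [b], the characteristic polynomial of [t] takes the value of the product of the
    [b - t^(p^i)], which is the norm [(b - t)^(1 + p + ... + p^(k-1))]. *)
Lemma chi_poly_descend k t : frob p k t = t ->
  chi_poly chi bs (descend iota k t) =
  chi (lower iota ((char_poly_at).[t] ^+ (\sum_(i < k) p ^ i)%N)).
Proof.
move=> ft; rewrite /chi_poly -[X in chi X = _](lowerK iota); congr (chi (lower _ _)).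
rewrite rmorph_prod /char_poly_at horner_prod -prodrXl; apply: eq_bigr => b _.
rewrite -horner_map map_descend // /orbit_poly horner_prod /orbit_seq /mkseq big_map.
rewrite !hornerE expr_sum -(big_mkord predT (fun i => (iota b - t) ^+ (p ^ i))).
rewrite /index_iota subn0; apply: eq_bigr => i _.
by rewrite hornerXsubC -/(frob p i (iota b - t)) frobB // frob_iota.
Qed.

(** Points are grouped by the norm [a] of [g(t)], an [M]-th power with [(p - 1) * M = q^2 - 1], and
    Stepanov's bound is applied to each class [a != 0]. The constant may depend on [p] and [cs],
    since it disappears in the passage to the inverse roots. *)
Lemma power_sum_bound : exists c : nat, exists k0 : nat,
  forall k, (k0 <= k)%N -> `|power_sum (k * 2)| <= c%:R * p%:R ^+ k.
Proof.
pose n := p.-1; pose m := (size cs).+1; pose w := (2 * n ^ 2 * (1 + n * m) + 1)%N.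
pose c := (1 + n * m + w)%N.
exists (c + m)%N, (n ^ 2).+1 => k kk.
have p1 := prime_gt1 p_pr.
have n0 : (0 < n)%N by rewrite -ltnS prednK // ltnW.
pose q := (p ^ k)%N; pose M := (\sum_(i < k * 2) p ^ i)%N.
have nq : (n ^ 2 < q)%N by apply: leq_ltn_trans (ltn_expl k p1); lia.
have k2 : (0 < k * 2)%N by lia.
have nM : ((n * M).+1 = q ^ 2)%N by rewrite /q -expnM -predn_exp prednK // expn_gt0 ltnW.
pose g := char_poly_at.
pose g1 : {poly K} := - \prod_(b <- cs) ((iota b)%:P - 'X).
have gE : g = 'X * g1.
  by rewrite /g /char_poly_at big_cons rmorph0 sub0r mulNr -mulrN.
have g10 : g1.[0] != 0.
  rewrite hornerN oppr_eq0 horner_prod prodf_seq_neq0; apply/allP => b bc.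
  rewrite !hornerE subr0 fmorph_eq0; apply: contra cs0 => /eqP <-; exact: bc.
have sg : size ('X * g1) = m.+1.
  rewrite mulrC size_mulX; last by apply: contra g10 => /eqP->; rewrite horner0.
  rewrite size_polyN; congr _.+1.
  have -> : \prod_(b <- cs) ((iota b)%:P - 'X) = (\prod_(b <- cs) (-1)) *: \prod_(b <- cs) ('X - (iota b)%:P).
    rewrite -scaler_prod; apply: eq_bigr => b _; by rewrite scaleN1r opprB.
  rewrite size_scale ?size_prod_XsubC // prodf_seq_neq0; apply/allP => b _.
  by rewrite oppr_eq0 oner_eq0.
pose Z := froots p K (k * 2).
pose y t := g.[t] ^+ M.
have fixZ t : t \in Z -> t ^+ (q ^ 2) = t.
  by rewrite /Z mem_froots // => /eqP; rewrite /frob expnM.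
have yZ t : t \in Z -> iota (lower iota (y t)) = y t.
  move=> tZ; apply: (iota_lower p_pr); rewrite /frob expn1.
  have := fixZ _ tZ; rewrite -[(q ^ 2)%N]expnM => ft.
  have gt : g.[t] ^+ (q ^ 2) = g.[t].
    rewrite /g /char_poly_at horner_prod -prodrXl; apply: eq_bigr => b _.
    rewrite !hornerE -[(q ^ 2)%N]expnM -/(frob p (k * 2) _) frobB // frob_iota //.
    by rewrite /frob ft.
  rewrite /y -exprM; have -> : (M * p = (n * M).+1 + M.-1)%N.
    have M0 : (0 < M)%N by rewrite lt0n; apply/eqP => M0; move: nM nq; rewrite M0; nia.
    rewrite -[p in LHS](@prednK p) ?(ltnW p1) // -/n; nia.
  rewrite exprD nM gt -exprS prednK //.
  by rewrite lt0n; apply/eqP => M0; move: nM nq; rewrite M0; nia.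
pose N a := count (fun t => y t == iota a) Z.
have SE : power_sum (k * 2) = \sum_a chi a * (N a)%:R.
  rewrite /power_sum -/Z big_seq.
  transitivity (\sum_(t <- Z) \sum_a chi a * (y t == iota a)%:R).
    rewrite [RHS]big_seq; apply: eq_bigr => t tZ.
    rewrite chi_poly_descend; last by have := tZ; rewrite /Z mem_froots // => /eqP.
    rewrite -/g -/M -/(y t) (bigD1 (lower iota (y t))) //= yZ // eqxx mulr1 big1 ?addr0 //.
    move=> a na; case: eqP => [E|]; last by rewrite mulr0.
    by case/negP: na; rewrite E lowerK.
  rewrite exchange_big /=; apply: eq_bigr => a _; rewrite -mulr_sumr; congr (_ * _).
  by rewrite /N -sum1_count natr_sum [RHS]big_mkcond /=; apply: eq_bigr => t _; case: (_ == _).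
have sumN : (\sum_a N a = q ^ 2)%N.
  transitivity (\sum_(t <- Z) 1)%N; last by rewrite sum1_size /Z size_froots // expnM.
  transitivity (\sum_a \sum_(t <- Z) (y t == iota a))%N.
    by apply: eq_bigr => a _; rewrite /N -sum1_count big_mkcond /=.
  rewrite exchange_big /= [LHS]big_seq [RHS]big_seq; apply: eq_bigr => t tZ.
  rewrite (bigD1 (lower iota (y t))) //= yZ // eqxx big1 // => a na.
  by case: eqP => // E; case/negP: na; rewrite E lowerK.
have N0 : (N 0%R <= m)%N.
  rewrite /N -size_filter -ltnS -sg; apply: max_poly_roots.
  - by rewrite -size_poly_eq0 sg.
  - apply/allP => t; rewrite mem_filter rmorph0 /y expf_eq0 -gE => /andP[/andP[_ h] _].
    exact: h.
  - by rewrite filter_uniq // uniq_froots.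
have Na a : a != 0 -> (n * N a <= q ^ 2 + q * c)%N.
  move=> a0; rewrite /N -size_filter.
  apply: (@stepanov_bound K p k n M m g1 (iota a)) => //.
  - exact: pchar_extension.
  - by rewrite fmorph_eq0.
  - by rewrite filter_uniq // uniq_froots.
  move=> t; rewrite mem_filter => /andP[/eqP yt tZ]; split; first exact: fixZ.
  by rewrite -gE.
pose B := (q ^ 2 + q * c)%N.
have n0C : 0 < n%:R :> C by rewrite ltr0n.
rewrite -(ler_pM2l n0C).
(* Stepanov bounds [n * N a] by [B] from above only. As [chi] sums to 0, the nonnegative deficiency
   [B - n * N a] can take its place; the deficiencies add up to [O(q)] because the [N a] add up to
   [q^2]. *)
have -> : n%:R * `|power_sum (k * 2)| = `|\sum_(a | a != 0) chi a * (B%:R - n%:R * (N a)%:R)|.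
  rewrite -[n%:R]ger0_norm ?ler0n // -normrM -normrN; congr `|_|.
  have := sum_chi chiM chi_np; rewrite (bigD1 0) //= chi0 add0r => S0.
  rewrite SE (bigD1 0) //= chi0 mul0r add0r mulr_sumr ger0_norm ?ler0n //.
  under [RHS]eq_bigr do rewrite mulrBr.
  rewrite sumrB -mulr_suml S0 mul0r sub0r; congr (- _).
  by apply: eq_bigr => a _; rewrite mulrCA.
apply: (le_trans (ler_norm_sum _ _ _)).
apply: (@le_trans _ _ (\sum_(a | a != 0 :> 'F_p) (B - n * N a)%:R)).
  apply: ler_sum => a a0; rewrite normrM natrB ?Na // natrM.
  rewrite -[leRHS]mul1r ler_pM ?normr_ge0 ?norm_chi_le1 //.
  by rewrite ger0_norm // subr_ge0 -natrM ler_nat Na.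
rewrite -natr_sum -natrX -!natrM ler_nat.
set X := (\sum_(a | _) (B - n * N a))%N.
pose Y := (\sum_(a | a != 0%R :> 'F_p) N a)%N.
have E : (X + n * Y = n * B)%N.
  rewrite /X /Y big_distrr /= -big_split /= (eq_bigr (fun=> B)) => [|a a0]; last by rewrite subnK // Na.
  rewrite sum_nat_const; congr (_ * _)%N.
  transitivity #|predC1 (0 : 'F_p)|; last by rewrite cardC1 card_Fp.
  by apply: eq_card => a; rewrite !inE.
have YE : (Y + N 0%R = q ^ 2)%N by rewrite -sumN [in RHS](bigD1 0%R) //= addnC.
move: E N0; rewrite /B => E N0; rewrite -/q.
have q0 : (0 < q)%N by rewrite expn_gt0 ltnW.
have : (n * Y + n * N 0%R = n * q ^ 2)%N by rewrite -mulnDr YE.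
have : (n * N 0%R <= n * (m * q))%N by rewrite leq_mul2l; apply/orP; right; nia.
lia.
Qed.

Lemma norm_lcoef1 : (forall x : C, exists n : nat, `|x| < n%:R) ->
  `|lcoef chi bs 1| <= (size (undup cs))%:R * sqrtC p%:R.
Proof.
move=> archi; set D := size (undup cs).
pose L := \poly_(i < D.+1) lcoef chi bs i.
have LE i : L`_i = lcoef chi bs i.
  rewrite coef_poly; case: ltnP => // h.
  by rewrite (lcoef_eq0 chiM (bs := bs) (a := 0) (cs := cs)).
have L0 : L`_0 = 1 by rewrite LE lcoef0.
have [ws sws wsE] := factor_unit_constant L0.
have {}wsE i : lcoef chi bs i = signed_esf ws i by rewrite -LE.
(* Both sides satisfy the same triangular recursion, whose leading coefficient is 1. *)
have PS k : power_sum k.+1 = - \sum_(w <- ws) w ^+ k.+1.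
  elim/ltn_ind: k => k IH.
  have := newton_lcoef k.+1; have := newton_signed_esf ws k.+1.
  rewrite wsE => ->; rewrite !big_nat_recr //= subnn wsE signed_esf0 !mulr1 opprD => E.
  apply: (addrI (- \sum_(0 <= i < k) (\sum_(w <- ws) w ^+ i.+1) * signed_esf ws (k.+1 - i.+1))).
  rewrite E; congr (_ + _); rewrite -sumrN; apply: eq_big_nat => i /andP[_ ik].
  by rewrite IH // wsE mulNr.
have p0 : 0 < p%:R :> C by rewrite ltr0n prime_gt0.
have [c [k0 Hc]] := power_sum_bound.
(* Squares of the inverse roots, whose power sums are the sums over extensions of even degree. *)
have zb z : z \in [seq w ^+ 2 | w <- ws] -> `|z| <= p%:R.
  apply: (@power_sum_root_bound _ _ c%:R _ k0.+1) => // k kk.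
  rewrite big_map (eq_bigr (fun w => w ^+ (k * 2))) => [|w _]; last by rewrite mulnC exprM.
  have -> : (k * 2 = (k * 2).-1.+1)%N by lia.
  rewrite -normrN -PS prednK ?muln_gt0 ?(leq_trans _ kk) //; apply: Hc; exact: ltnW.
have wb w : w \in ws -> `|w| <= sqrtC p%:R.
  move=> ww; have := zb _ (map_f _ ww); rewrite normrX => h.
  by rewrite -(@ler_pXn2r _ 2) ?nnegrE ?sqrtC_ge0 ?ler0n // sqrtCK.
have := newton_lcoef 1; rewrite big_nat1 subnn lcoef0 // mulr1n mul1r mulr1 PS => ->.
rewrite normrN; apply: (le_trans (ler_norm_sum _ _ _)).
apply: (@le_trans _ _ (\sum_(w <- ws) sqrtC p%:R)).
  by rewrite [leLHS]big_seq [leRHS]big_seq; apply: ler_sum => w ww; rewrite expr1 wb.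
rewrite big_const_seq count_predT iter_addr_0 -[leLHS]mulr_natl.
apply: ler_wpM2r; first by rewrite sqrtC_ge0 ler0n.
rewrite ler_nat.
by have := leq_trans sws (size_poly _ _); rewrite ltnS.
Qed.

End WeilBound.

(** Normalized so that the simple factor is [t] itself; translation gives the other cases. The
    degree of the L-polynomial is at most the number of distinct remaining shifts, so their
    exponents do not affect the bound. *)
Theorem weil_bound (p : nat) (C : numClosedFieldType) (chi : 'F_p -> C) (cs : seq 'F_p) :
  prime p -> (forall x : C, exists n : nat, `|x| < n%:R) ->
  chi 0 = 0 -> chi 1 = 1 -> (forall x y, chi (x * y) = chi x * chi y) ->
  (exists2 x, x != 0 & chi x != 1) -> 0 \notin cs ->
  `|\sum_t chi (t * \prod_(b <- cs) (t + b))| <= (size (undup cs))%:R * sqrtC p%:R.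
Proof.
move=> p_pr archi chi0 chi1 chiM chi_np cs0.
have [K [iota _]] := closed_field.countable_algebraic_closure 'F_p.
have := norm_lcoef1 p_pr iota chi0 chi1 chiM chi_np cs0 archi.
rewrite lcoef1; under eq_bigr do rewrite big_cons addr0.
exact.
Qed.

(** * Moments of short character sums *)

Section BurgessMoment.
Variables (p : nat) (p_pr : prime p) (C : numClosedFieldType).
Hypothesis archi : forall x : C, exists n : nat, `|x| < n%:R.

Lemma weil_bound_simple_shift (chi : 'F_p -> C) (I : finType) (b : I -> 'F_p)
    (e : I -> nat) (i0 : I) :
  chi 0 = 0 -> chi 1 = 1 -> (forall x y, chi (x * y) = chi x * chi y) ->
  (exists2 x, x != 0 & chi x != 1) -> e i0 = 1%N ->
  (forall j, j != i0 -> b j != b i0) ->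
  `|\sum_x chi (\prod_i (x + b i) ^+ e i)| <= #|I|%:R * sqrtC p%:R.
Proof.
move=> chi0 chi1 chiM np e0 bi.
pose J := [seq j <- enum I | j != i0].
pose cs := flatten [seq nseq (e j) (b j - b i0) | j <- J].
have cs0 : 0 \notin cs.
  apply/negP => /flattenP[s /mapP[j]]; rewrite mem_filter => /andP[/bi nj _ ->].
  by rewrite mem_nseq => /andP[_]; rewrite eq_sym subr_eq0 (negbTE nj).
have := weil_bound p_pr archi chi0 chi1 chiM np cs0.
have -> : \sum_t chi (t * \prod_(c <- cs) (t + c)) = \sum_x chi (\prod_i (x + b i) ^+ e i).
  rewrite [RHS](reindex (fun t => t - b i0)) /=; last first.
    by exists (fun t => t + b i0) => t _; rewrite ?subrK ?addrK.
  apply: eq_bigr => t _; congr (chi _); rewrite [RHS](bigD1 i0) //= subrK e0 expr1.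
  congr (_ * _); rewrite big_flatten big_map /J big_filter big_enum_cond /=.
  apply: eq_big => [j|j _]; first by rewrite ?inE ?andTb.
  by rewrite big_nseq iter_mulr_1 addrA addrAC.
move=> h; apply: (le_trans h); apply: ler_wpM2r; first by rewrite sqrtC_ge0 ler0n.
rewrite ler_nat cardE; apply: (@leq_trans (size [seq b j - b i0 | j <- J])).
  apply: uniq_leq_size; first exact: undup_uniq.
  move=> c; rewrite mem_undup => /flattenP[s /mapP[j jJ ->]].
  by rewrite mem_nseq => /andP[_ /eqP ->]; apply/mapP; exists j.
by rewrite size_map size_filter count_size.
Qed.

(* If no value is taken exactly once, there are at most [r] values, so [f] factors
   through ['I_r]. *)
Lemma card_ffun_no_simple_value (r B : nat) (I : finType) : (0 < r)%N -> #|I| = (2 * r)%N ->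
  (#|[set f : {ffun I -> 'I_B} | ~~ [exists i, [forall (j | j != i), f j != f i]]]|
     <= r ^ (2 * r) * B ^ r)%N.
Proof.
move=> r0 cI; pose comp (ch : {ffun 'I_r -> 'I_B} * {ffun I -> 'I_r}) : {ffun I -> 'I_B} :=
  [ffun i => ch.1 (ch.2 i)].
apply: (@leq_trans #|[set comp ch | ch in {: {ffun 'I_r -> 'I_B} * {ffun I -> 'I_r}}]|); last first.
  apply: (leq_trans (leq_imset_card _ _)).
  by rewrite cardT -cardE card_prod !card_ffun !card_ord cI mulnC.
apply/subset_leq_card/subsetP => f; rewrite inE => /existsPn bad.
have [i1 _] : exists i1 : I, i1 \in I by apply/card_gt0P; rewrite cI muln_gt0 r0.
pose s := undup (codom f).
have s2 : (size s <= r)%N.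
  rewrite -(leq_pmul2l (isT : 0 < 2)%N) -cI.
  have -> : #|I| = (\sum_(y <- s) count_mem y (codom f))%N.
    under eq_bigr do rewrite -sum1_count big_mkcond /=.
    rewrite exchange_big /= -(size_codom f) -sum1_size big_seq [RHS]big_seq.
    apply: eq_bigr => y yf; transitivity (count_mem y s).
      by rewrite count_uniq_mem ?undup_uniq // mem_undup yf.
    by rewrite -sum1_count big_mkcond /=; apply: eq_bigr => z _; rewrite eq_sym.
  rewrite mulnC -sum1_size big_distrl /= big_seq [leqRHS]big_seq; apply: leq_sum => y.
  rewrite mem_undup => /codomP[i ->]; rewrite mul1n.
  have /forallPn[j] := bad i; rewrite negb_imply negbK => /andP[ji /eqP fj].
  rewrite /codom /image_mem count_map.
  have -> : count (preim f (pred1 (f i))) (enum I) = #|[pred k | f k == f i]|.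
    rewrite -size_filter cardE; congr size; rewrite !enumT /=.
    by rewrite /enum_mem -enumT; apply: eq_filter => k; rewrite !inE.
  have := @subset_leq_card _ (pred2 i j) [pred k | f k == f i].
  rewrite card2 eq_sym ji; apply; apply/subsetP => k; rewrite !inE.
  by case/orP => /eqP ->; rewrite ?fj eqxx.
have ix i : (index (f i) s < r)%N.
  by apply: leq_trans s2; rewrite index_mem mem_undup codom_f.
apply/imsetP; exists ([ffun k : 'I_r => nth (f i1) s k], [ffun i => Ordinal (ix i)]) => //.
by apply/ffunP => i; rewrite !ffunE /= nth_index // mem_undup codom_f.
Qed.

(** The two terms come from two kinds of tuples: those in which no value is taken exactly once are
    few and get the trivial bound [p], the others get Weil's bound. [B < p] keeps distinct shifts
    distinct modulo [p]. *)
Theorem burgess_moment (chi : 'F_p -> C) (B r : nat) :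
  chi 0 = 0 -> chi 1 = 1 -> (forall x y, chi (x * y) = chi x * chi y) ->
  (exists2 x, x != 0 & chi x != 1) -> (2 < p)%N -> (0 < r)%N -> (B < p)%N ->
  \sum_x `|\sum_(b < B) chi (x + b.+1%:R)| ^+ (2 * r) <=
    (r ^ (2 * r) * B ^ r * p)%:R + (2 * r * B ^ (2 * r))%:R * sqrtC p%:R.
Proof.
move=> chi0 chi1 chiM np p2 r0 Bp.
(* The conjugate of [chi] is [chi ^+ (p - 2)], also at 0. *)
pose chi' x := (chi x)^*.
have chi'E x : chi' x = chi (x ^+ (p - 2)).
  rewrite chiX //; case: (eqVneq x 0) => [->|x0].
    by rewrite /chi' chi0 rmorph0 expr0n subn_eq0 leqNgt p2.
  have cx : chi x != 0 by rewrite -normr_gt0 norm_chi ?ltr01.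
  apply: (mulfI cx); rewrite -exprS /chi' -normCK norm_chi // expr1n -chiX //.
  have -> : ((p - 2).+1 = p.-1)%N by lia.
  have : x ^+ p = x by have := expf_card x; rewrite card_Fp.
  move=> xp; rewrite (_ : x ^+ p.-1 = 1) ?chi1 //; apply: (mulfI x0).
  by rewrite -exprS prednK ?mulr1 // (ltn_trans _ p2).
have chi'K x : chi x = chi' (x ^+ (p - 2)).
  by rewrite {1}/chi' -chi'E /chi' conjCK.
pose I := (bool * 'I_r)%type.
have cI : #|{: I}| = (2 * r)%N by rewrite card_prod card_bool card_ord.
pose e (i : I) := if i.1 then 1%N else (p - 2)%N.
pose S x := \sum_(b < B) chi (x + b.+1%:R).
have expand x : `|S x| ^+ (2 * r) =
    \sum_(f : {ffun I -> 'I_B}) chi (\prod_i (x + (f i).+1%:R) ^+ e i).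
  transitivity (\prod_(i : I) \sum_(b < B) chi ((x + b.+1%:R) ^+ e i)).
    rewrite exprM normCK -(pair_bigA _ (fun a i => \sum_(b < B) chi ((x + b.+1%:R) ^+ e (a, i)))) /=.
    have cst (c : C) : c ^+ r = \prod_(j < r) c by rewrite big_const_ord iter_mulr_1.
    rewrite big_bool /= exprMn !cst; congr (_ * _); apply: eq_bigr => j _.
    by rewrite /S rmorph_sum; apply: eq_bigr => b _; rewrite /= -/(chi' _) chi'E.
  rewrite bigA_distr_bigA /=; apply: eq_bigr => f _.
  by rewrite chi_prod.
rewrite (eq_bigr _ (fun x _ => expand x)) exchange_big /=.
(* Before the exchange of sums the terms are nonnegative, so the total equals its norm and the
   triangle inequality over [f] applies. *)
have real_sum : `|\sum_(f : {ffun I -> 'I_B}) \sum_x chi (\prod_i (x + (f i).+1%:R) ^+ e i)| =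
   \sum_(f : {ffun I -> 'I_B}) \sum_x chi (\prod_i (x + (f i).+1%:R) ^+ e i).
  rewrite exchange_big /= ger0_norm //; apply: sumr_ge0 => x _.
  by rewrite -expand exprn_ge0.
rewrite -real_sum; apply: (le_trans (ler_norm_sum _ _ _)).
pose good (f : {ffun I -> 'I_B}) := [exists i, [forall (j | j != i), f j != f i]].
rewrite (bigID (fun f => ~~ good f)) /=; apply: lerD.
  apply: (@le_trans _ _ (\sum_(f : {ffun I -> 'I_B} | ~~ good f) p%:R)).
    apply: ler_sum => f _; apply: (le_trans (ler_norm_sum _ _ _)).
    rewrite -[p in leRHS](card_Fp p_pr) -sum1_card natr_sum; apply: ler_sum => x _.
    exact: norm_chi_le1.
  rewrite sumr_const -[leLHS]mulr_natr -natrM ler_nat mulnC leq_mul2r; apply/orP; right.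
  apply: leq_trans (card_ffun_no_simple_value B r0 cI).
  by rewrite cardsE.
under eq_bigl do rewrite negbK.
apply: (@le_trans _ _ (\sum_(f : {ffun I -> 'I_B} | good f) ((2 * r)%:R * sqrtC p%:R))).
  apply: ler_sum => f /existsP[i0 /forallP simple].
  have bi j : j != i0 -> (f j).+1%:R != (f i0).+1%:R :> 'F_p.
    move=> ji; have := simple j; rewrite ji /=; apply: contra => /eqP E.
    apply/eqP/val_inj/succn_inj; have := congr1 (fun z : 'F_p => val z) E.
    by rewrite /= !val_Fp_nat // !modn_small // (leq_ltn_trans (ltn_ord _) Bp).
  rewrite -cI; case: i0 simple bi => -[] k simple bi.
    exact: (@weil_bound_simple_shift chi I (fun i => (f i).+1%:R) e (true, k)).
  (* The simple value sits on a conjugated factor, of exponent [p - 2]; exchanging the roles of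
     [chi] and its conjugate gives this factor exponent 1. *)
  pose e' (i : I) := if i.1 then (p - 2)%N else 1%N.
  have -> : \sum_x chi (\prod_i (x + (f i).+1%:R) ^+ e i) =
     \sum_x chi' (\prod_i (x + (f i).+1%:R) ^+ e' i).
    apply: eq_bigr => x _; rewrite /chi' !chi_prod // rmorph_prod; apply: eq_bigr => -[[] i] _ /=.
      by rewrite /e /e' /= chi'K.
    by rewrite /e /e' /= -chi'E.
  apply: (@weil_bound_simple_shift chi' I (fun i => (f i).+1%:R) e' (false, k)) => //.
  - by rewrite /chi' chi0 rmorph0.
  - by rewrite /chi' chi1 rmorph1.
  - by move=> x y; rewrite /chi' chiM rmorphM.
  - case: np => x x0 cx; exists x => //; rewrite /chi'; apply: contra cx => /eqP h.
    by rewrite -[chi x]conjCK h rmorph1.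
rewrite sumr_const -[leLHS]mulr_natr mulrAC -natrM; apply: ler_wpM2r.
  by rewrite sqrtC_ge0 ler0n.
rewrite ler_nat leq_mul2l; apply/orP; right.
apply: (leq_trans (max_card _)); by rewrite card_ffun card_ord cI.
Qed.

End BurgessMoment.

(** * Divisors, products and small residues *)

Lemma size_divisors_part p n : (0 < n)%N ->
  (size (divisors n) <= size (divisors n`_p) * size (divisors n`_p^'))%N.
Proof.
move=> n0; rewrite -(size_allpairs muln); apply: uniq_leq_size.
  exact: divisors_uniq.
move=> d; rewrite -dvdn_divisors // => dn; have d0 := dvdn_gt0 n0 dn.
apply/allpairsP; exists (d`_p, d`_p^')%N => /=; rewrite -!dvdn_divisors ?part_gt0 //.
by rewrite !partn_dvd // partnC.
Qed.

Lemma size_divisors_prime_pow p e : prime p -> (size (divisors (p ^ e)) <= e.+1)%N.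
Proof.
move=> pp; rewrite -[leqRHS](size_iota 0) -[leqRHS](size_map (expn p)).
apply: uniq_leq_size; first exact: divisors_uniq.
move=> d; rewrite -dvdn_divisors ?expn_gt0 ?prime_gt0 // => /dvdn_pfactor.
by move=> /(_ pp)[m me ->]; apply: map_f; rewrite mem_iota.
Qed.

Lemma succn_expn_le k e : (0 < k)%N -> (e.+1 ^ k <= k ^ k * 2 ^ e)%N.
Proof.
move=> k0; have h : (e.+1 <= k * 2 ^ (e %/ k))%N.
  apply: (@leq_trans (k * (e %/ k).+1)); last by rewrite leq_mul2l ltn_expl ?orbT.
  by rewrite mulnC mulSn addnC {1}(divn_eq e k) -addnS leq_add2l ltn_mod.
have := leq_exp2r _ _ k0; move/(_ e.+1 (k * 2 ^ (e %/ k))%N); rewrite h => /idP h'.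
apply: leq_trans h' _; rewrite expnMn leq_mul2l -expnM; apply/orP; right.
by rewrite leq_exp2l // leq_trunc_div.
Qed.

(** Prime by prime: for [p >= 2^k] one has [(e + 1)^k <= 2^(e * k) <= p^e], and each of the at most
    [2^k] smaller primes costs a factor [k^k]. The number of divisors is thus [O(n^(1/k))]. *)
Lemma size_divisors_bound k : (0 < k)%N ->
  exists C : nat, forall n, (0 < n)%N -> (size (divisors n) ^ k <= C * n)%N.
Proof.
move=> k0; exists ((k ^ k) ^ (2 ^ k))%N.
pose bad n := count (fun q => q < 2 ^ k)%N (primes n).
suff key n : (0 < n)%N -> (size (divisors n) ^ k <= (k ^ k) ^ bad n * n)%N.
  move=> n n0; apply: (leq_trans (key n n0)); rewrite leq_mul2r; apply/orP; right.
  apply: leq_pexp2l; first by rewrite expn_gt0 k0.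
  rewrite /bad -size_filter -[leqRHS](size_iota 0); apply: uniq_leq_size.
    by rewrite filter_uniq ?primes_uniq.
  by move=> q; rewrite mem_filter mem_iota => /andP[].
elim/ltn_ind: n => n IH n0; have [n1|n1] := leqP n 1.
  have -> : n = 1%N by lia.
  by rewrite /bad /= exp1n.
pose p := pdiv n; have pp : prime p := pdiv_prime n1.
have pn : p \in primes n by rewrite mem_primes pp n0 pdiv_dvd.
set m := (n`_p^')%N; set e := logn p n.
have nE : (n = p ^ e * m)%N by rewrite -p_part partnC.
have m0 : (0 < m)%N by rewrite part_gt0.
have e0 : (0 < e)%N by rewrite logn_gt0.
have mn : (m < n)%N.
  rewrite [ltnRHS]nE -[ltnLHS]mul1n ltn_pmul2r // -[1%N](expn0 p) ltn_exp2l //.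
  exact: prime_gt1.
have badE : bad n = (bad m + (p < 2 ^ k))%N.
  rewrite /bad primes_part count_filter -[LHS]size_filter.
  rewrite -[LHS](count_predC (mem (p^')%N)) !count_filter.
  congr (_ + _)%N; first by apply: eq_count => q /=; rewrite andbC.
  transitivity (count (fun q => (q == p) && (p < 2 ^ k)%N) (primes n)).
    by apply: eq_count => q /=; rewrite !inE negbK; case: eqP => // ->.
  case: (p < 2 ^ k)%N; last by rewrite (eq_count (a2 := pred0)) ?count_pred0 // => q; rewrite andbF.
  rewrite (eq_count (a2 := pred1 p)) => [|q]; last by rewrite andbT.
  by rewrite count_uniq_mem ?primes_uniq // pn.
have := IH m mn m0 => {}IH.
have h1 := size_divisors_part p n0.
have h2 : (size (divisors n`_p) <= e.+1)%N by rewrite p_part size_divisors_prime_pow.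
have h3 : (size (divisors n) ^ k <= e.+1 ^ k * size (divisors m) ^ k)%N.
  rewrite -expnMn leq_exp2r //; apply: (leq_trans h1); by rewrite leq_mul2r h2 orbT.
apply: (leq_trans h3); rewrite badE expnD [X in (_ <= _ * X)%N]nE.
have h4 : (e.+1 ^ k <= (k ^ k) ^ (p < 2 ^ k)%N * p ^ e)%N.
  case: ltnP => pk.
    rewrite expn1; apply: (leq_trans (succn_expn_le e k0)); rewrite leq_mul2l.
    by rewrite leq_exp2r // prime_gt1 // orbT.
  rewrite expn0 mul1n; apply: (@leq_trans ((2 ^ e) ^ k)).
    by rewrite leq_exp2r // ltn_expl.
  by rewrite -expnM mulnC expnM leq_exp2r.
apply: (leq_trans (leq_mul h4 IH)); apply/eq_leq; ring.
Qed.

Lemma sum_mul_eq_le X Y M : (0 < M)%N ->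
  (\sum_(1 <= h < X) \sum_(1 <= m < Y) (h * m == M) <= size (divisors M))%N.
Proof.
move=> M0; apply: (@leq_trans (\sum_(1 <= h < X) (h %| M))%N).
  rewrite big_nat [leqRHS]big_nat; apply: leq_sum => h /andP[h0 _].
  have [/dvdnP[m ->]|nd] := boolP (h %| M)%N; last first.
    rewrite big1 // => m _; case: eqP => // E; case/negP: nd.
    by rewrite -E dvdn_mulr.
  apply: (@leq_trans (count (pred1 m) (index_iota 1 Y))).
    rewrite -sum1_count [leqRHS]big_mkcond /=; apply: leq_sum => i _.
    by rewrite mulnC eqn_pmul2r //; case: (i == m).
  by rewrite count_uniq_mem ?iota_uniq //; case: (_ \in _).
have -> : (\sum_(1 <= h < X) (h %| M) = size [seq h <- index_iota 1 X | (h %| M)%N])%N.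
  by rewrite size_filter -sum1_count [RHS]big_mkcond /=; apply: eq_bigr => h _; case: (h %| M)%N.
apply: uniq_leq_size; first by rewrite filter_uniq ?iota_uniq.
by move=> h; rewrite mem_filter -dvdn_divisors // => /andP[].
Qed.

(** Each factor is moved into the predicate, so inductions on [j] must be uniform in [Q]. *)
Fixpoint product_count (U j : nat) (Q : pred nat) : nat :=
  if j is j'.+1 then (\sum_(0 <= h < U) product_count U j' (fun m => Q (h * m)%N))%N
  else Q 1%N.

Lemma eq_product_count U j (Q Q' : pred nat) : Q =1 Q' ->
  product_count U j Q = product_count U j Q'.
Proof.
elim: j Q Q' => [|j IH] Q Q' E /=; first by rewrite E.
by apply: eq_bigr => h _; apply: IH => m; rewrite E.
Qed.

Lemma product_count_le U j (Q : pred nat) : (product_count U j Q <= U ^ j)%N.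
Proof.
elim: j Q => [|j IH] Q /=; first by case: (Q _).
apply: (@leq_trans (\sum_(0 <= h < U) U ^ j)%N); first by apply: leq_sum.
by rewrite sum_nat_const_nat subn0 expnS.
Qed.

(** Tuples with a zero factor number at most [j * U^(j-1)]. Any other product arises at most [T^j]
    times, since each factor divides a positive integer at most [U^j]. *)
Lemma product_count_bound U j T (Q : pred nat) : (0 < U)%N -> (0 < T)%N ->
  (forall m, 0 < m <= U ^ j -> size (divisors m) <= T)%N ->
  (product_count U j Q <= j * U ^ j.-1 + T ^ j * \sum_(1 <= m < (U ^ j).+1) Q m)%N.
Proof.
move=> U0 T0; elim: j Q => [|j IH] Q HT.
  by rewrite expn0 mul0n add0n mul1n big_nat1.
have HTj m : (0 < m <= U ^ j)%N -> (size (divisors m) <= T)%N.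
  case/andP => m0 mU; apply: HT; rewrite m0 (leq_trans mU) //.
  by rewrite leq_pexp2l.
rewrite [product_count _ _ _]/= -[j.+1.-1]/j mulSn -addnA big_ltn //; apply: leq_add.
  exact: product_count_le.
apply: (@leq_trans (\sum_(1 <= h < U) (j * U ^ j.-1 + T ^ j * \sum_(1 <= m < (U ^ j).+1) Q (h * m)))%N).
  by apply: leq_sum => h _; apply: IH.
rewrite big_split /=; apply: leq_add.
  rewrite sum_nat_const_nat; apply: (@leq_trans (U * (j * U ^ j.-1))).
    by rewrite leq_mul2r leq_subr orbT.
  by rewrite mulnCA; case: (j) => // j'; rewrite expnS.
rewrite -big_distrr /= expnSr -mulnA leq_mul2l; apply/orP; right.
rewrite big_distrr /=.
apply: (@leq_trans (\sum_(1 <= M < (U ^ j.+1).+1)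
    (\sum_(1 <= h < U) \sum_(1 <= m < (U ^ j).+1) (h * m == M)) * Q M))%N; last first.
  rewrite big_nat [leqRHS]big_nat; apply: leq_sum => M /andP[M0 MU].
  rewrite leq_mul2r; apply/orP; right; apply: (leq_trans (sum_mul_eq_le _ _ M0)).
  by apply: HT; rewrite M0.
under [leqRHS]eq_bigr do rewrite big_distrl /=.
rewrite [leqRHS]exchange_big /= big_nat [leqRHS]big_nat; apply: leq_sum => h /andP[h0 hU].
under [leqRHS]eq_bigr do rewrite big_distrl /=.
rewrite [leqRHS]exchange_big /= big_nat [leqRHS]big_nat; apply: leq_sum => m /andP[m0 mU].
have hm : (0 < h * m < (U ^ j.+1).+1)%N.
  by rewrite muln_gt0 h0 m0 /= ltnS expnS leq_mul // ltnW.
rewrite (bigD1_seq (h * m)%N) ?iota_uniq ?mem_index_iota //= eqxx mul1n leq_addr //.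
Qed.

Section Small.
Variable F : finFieldType.

(* The residues of the integers in [-H, H]. *)
Definition small (H : nat) (x : F) := [exists n : 'I_H.+1, (x == n%:R) || (x == - n%:R)].

Lemma smallP H x : reflect (exists2 n, (n <= H)%N & x = n%:R \/ x = - n%:R) (small H x).
Proof.
apply: (iffP existsP) => [[n /orP[] /eqP->]|[n nH [] ->]].
- by exists n; [rewrite -ltnS | left].
- by exists n; [rewrite -ltnS | right].
- by exists (Ordinal (nH : n < H.+1)%N); rewrite eqxx.
- by exists (Ordinal (nH : n < H.+1)%N); rewrite eqxx orbT.
Qed.

Lemma small_natB H n m : (n <= H)%N -> (m <= H)%N -> small H (n%:R - m%:R).
Proof.
move=> nH mH; apply/smallP; case: (leqP m n) => mn.
  by exists (n - m)%N; [lia | left; rewrite natrB].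
by exists (m - n)%N; [lia | right; rewrite natrB ?opprB // ltnW].
Qed.

Lemma small_sub H x y : small H x -> small H y -> small (2 * H) (x - y).
Proof.
case/smallP => n nH hx /smallP[m mH hy].
have [nH2 mH2] : (n <= 2 * H)%N /\ (m <= 2 * H)%N by lia.
case: hx => ->; case: hy => ->; rewrite ?opprK.
- exact: small_natB.
- by apply/smallP; exists (n + m)%N; [lia | left; rewrite natrD].
- by apply/smallP; exists (n + m)%N; [lia | right; rewrite natrD opprD].
- by rewrite addrC small_natB.
Qed.

Lemma card_small H : (#|[pred x | small H x]| <= 2 * H.+1)%N.
Proof.
have sub : [pred x | small H x] \subset
    [set (if i.1 then i.2%:R else - i.2%:R : F) | i : bool * 'I_H.+1].
  apply/subsetP => x; rewrite inE => /existsP[n /orP[] /eqP->].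
    by apply/imsetP; exists (true, n).
  by apply/imsetP; exists (false, n).
apply: (leq_trans (subset_leq_card sub)); apply: (leq_trans (leq_imset_card _ _)).
by rewrite card_prod card_bool card_ord.
Qed.
End Small.

Lemma sum_nat_Fp (p L : nat) (G : 'F_p -> nat) : prime p ->
  (\sum_(0 <= m < L * p) G (m%:R)%R = L * \sum_x G x)%N.
Proof.
move=> pp; have one : (\sum_(0 <= m < p) G (m%:R)%R = \sum_x G x)%N.
  rewrite -[X in index_iota _ X](Fp_cast pp) big_mkord; apply: eq_bigr => x _.
  by rewrite natr_Zp.
elim: L => [|L IH]; first by rewrite mul0n big_geq.
rewrite !mulSn addnC (@big_cat_nat _ _ _ (L * p)) ?leq_addr //= IH addnC; congr (_ + _)%N.
rewrite -one -{1}[(L * p)%N]add0n big_addn addKn; apply: eq_bigr => m _.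
by rewrite natrD natrM pchar_Fp_0 // mulr0 addr0.
Qed.

(** Multiplication by [b] permutes each complete system of residues, and [M %/ p + 1] such systems
    cover the range. *)
Lemma count_small_multiples (p : nat) (b : 'F_p) (M H : nat) : prime p -> b != 0 ->
  (\sum_(1 <= m < M.+1) small H (b * m%:R)%R <= (M %/ p).+1 * (2 * H.+1))%N.
Proof.
move=> pp b0; apply: (@leq_trans (\sum_(0 <= m < (M %/ p).+1 * p) small H (b * m%:R)%R)%N).
  rewrite [leqRHS](@big_cat_nat _ _ _ 1) ?muln_gt0 ?(prime_gt0 pp) //=.
  apply: leq_trans (leq_addl _ _).
  rewrite [leqRHS](@big_cat_nat _ _ _ M.+1) //= ?leq_addr //.
  by rewrite -ltn_divLR ?prime_gt0.
rewrite [leqLHS](_ : _ = (M %/ p).+1 * \sum_x small H (b * x)%R)%N; last first.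
  exact: (@sum_nat_Fp p (M %/ p).+1 (fun x => small H (b * x)%R) pp).
rewrite leq_mul2l; apply/orP; right.
rewrite (reindex_inj (h := fun x => b^-1 * x)) /=; last by apply: mulfI; rewrite invr_eq0.
under eq_bigr do rewrite mulVKf //.
apply: leq_trans (card_small _ H); rewrite -sum1_card [leqRHS]big_mkcond /=.
by apply: leq_sum => x _; rewrite inE; case: small.
Qed.

(** * Weyl differencing and multiplicative energy *)

Lemma cauchy_schwarz_sum (R : realFieldType) (I : finType) (a b : I -> R) :
  (\sum_i a i * b i) ^+ 2 <= (\sum_i a i ^+ 2) * (\sum_i b i ^+ 2).
Proof.
rewrite -subr_ge0 -(pmulr_rge0 _ (ltr0n R 2)).
have -> : 2 * ((\sum_i a i ^+ 2) * (\sum_i b i ^+ 2) - (\sum_i a i * b i) ^+ 2) =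
    \sum_i \sum_j (a i * b j - a j * b i) ^+ 2.
  transitivity (\sum_i \sum_j (a i ^+ 2 * b j ^+ 2) + \sum_i \sum_j (b i ^+ 2 * a j ^+ 2)
     - 2 * \sum_i \sum_j (a i * b i * (a j * b j))).
    rewrite -!big_distrlr /=; ring.
  rewrite mulr_sumr -big_split -sumrB /=; apply: eq_bigr => i _.
  by rewrite mulr_sumr -big_split -sumrB /=; apply: eq_bigr => j _; ring.
by apply: sumr_ge0 => i _; apply: sumr_ge0 => j _; exact: sqr_ge0.
Qed.

Lemma weighted_cauchy_schwarz (R : realFieldType) (I : finType) (N F : I -> R) :
  (forall i, 0 <= N i) ->
  (\sum_i N i * F i) ^+ 2 <= (\sum_i N i) * (\sum_i N i * F i ^+ 2).
Proof.
move=> N0; rewrite -subr_ge0 -(pmulr_rge0 _ (ltr0n R 2)).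
have -> : 2 * ((\sum_i N i) * (\sum_i N i * F i ^+ 2) - (\sum_i N i * F i) ^+ 2) =
    \sum_i \sum_j N i * N j * (F i - F j) ^+ 2.
  transitivity (\sum_i \sum_j (N i * (N j * F j ^+ 2)) + \sum_i \sum_j (N i * F i ^+ 2 * N j)
     - 2 * \sum_i \sum_j (N i * F i * (N j * F j))).
    rewrite -!big_distrlr /=; ring.
  rewrite mulr_sumr -big_split -sumrB /=; apply: eq_bigr => i _.
  by rewrite mulr_sumr -big_split -sumrB /=; apply: eq_bigr => j _; ring.
apply: sumr_ge0 => i _; apply: sumr_ge0 => j _.
by rewrite mulr_ge0 ?sqr_ge0 // mulr_ge0.
Qed.

(** Hoelder's inequality for exponents [2^j], by repeated use of the weighted Cauchy-Schwarz
    inequality. *)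
Lemma weighted_power_mean (R : realFieldType) (I : finType) (N F : I -> R) j :
  (forall i, 0 <= N i) -> (forall i, 0 <= F i) ->
  (\sum_i N i * F i) ^+ (2 ^ j) <= (\sum_i N i) ^+ (2 ^ j - 1) * (\sum_i N i * F i ^+ (2 ^ j)).
Proof.
move=> N0 F0; elim: j => [|j IH]; first by rewrite expn0 subnn expr0 mul1r !expr1.
rewrite expnSr exprM; apply: (@le_trans _ _ (((\sum_i N i) ^+ (2 ^ j - 1) * \sum_i N i * F i ^+ (2 ^ j)) ^+ 2)).
  rewrite ler_pXn2r // nnegrE; first by rewrite exprn_ge0 // sumr_ge0 // => i _; rewrite mulr_ge0.
  rewrite mulr_ge0 ?exprn_ge0 ?sumr_ge0 // => i _; by rewrite mulr_ge0 ?exprn_ge0.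
rewrite exprMn; apply: (le_trans (ler_wpM2l _ (weighted_cauchy_schwarz (fun i => F i ^+ (2 ^ j)) N0))).
  by rewrite !exprn_ge0 // sumr_ge0.
have -> : \sum_i N i * F i ^+ (2 ^ j) ^+ 2 = \sum_i N i * F i ^+ (2 ^ j * 2).
  by apply: eq_bigr => i _; rewrite exprM.
set X := \sum_i N i; set Y := \sum_i _.
have -> : (2 ^ j * 2 - 1 = ((2 ^ j - 1) * 2).+1)%N by have := expn_gt0 2 j; lia.
by rewrite [X ^+ (_ * 2).+1]exprSr exprM mulrA.
Qed.

Lemma power_mean_nat U j (y : nat -> nat) :
  ((\sum_(0 <= h < U) y h) ^ (2 ^ j) <= U ^ (2 ^ j - 1) * \sum_(0 <= h < U) y h ^ (2 ^ j))%N.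
Proof.
have E := @weighted_power_mean rat 'I_U (fun=> 1) (fun h => (y h)%:R) j (fun=> ler01) (fun=> ler0n _ _).
rewrite sumr_const card_ord in E.
rewrite -(ler_nat rat) natrM !natrX !natr_sum !big_mkord.
rewrite [X in X ^+ _ <= _](eq_bigr (fun h : 'I_U => 1 * (y h)%:R)) => [|h _]; last by rewrite mul1r.
rewrite [X in _ <= _ * X](eq_bigr (fun h : 'I_U => 1 * (y h)%:R ^+ (2 ^ j))) // => h _.
by rewrite natrX mul1r.
Qed.

Section WeylDifferencing.
Variable F : finFieldType.
Implicit Types f : {poly F}.

Definition poly_diff f (h : F) := f \Po ('X + h%:P) - f.

Lemma coef_comp_XaddC f h k : (size f <= k.+1)%N -> (f \Po ('X + h%:P))`_k = f`_k.
Proof.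
elim/poly_ind: f k => [|f c IH] k; first by rewrite comp_poly0.
have [->|f0] := eqVneq f 0; first by rewrite mul0r add0r comp_polyC.
rewrite size_MXaddC (negbTE f0) /= ltnS => sf.
rewrite comp_polyD comp_polyM comp_polyX comp_polyC mulrDr !coefD coefMC !coefMX.
rewrite [(_ \Po _)`_k]nth_default; last first.
  by rewrite size_comp_poly2 ?size_XaddC.
case: k sf => [|k] sf /=; last by rewrite IH // mul0r addr0.
by rewrite leqn0 size_poly_eq0 (negbTE f0) in sf.
Qed.

Lemma coef_comp_XaddC_subleading f h k : (size f <= k.+2)%N ->
  (f \Po ('X + h%:P))`_k = f`_k + k.+1%:R * h * f`_k.+1.
Proof.
elim/poly_ind: f k => [|f c IH] k; first by rewrite comp_poly0 !coef0 mulr0 addr0.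
have [->|f0] := eqVneq f 0.
  by rewrite mul0r add0r comp_polyC !coefC mulr0 addr0.
rewrite size_MXaddC (negbTE f0) /= ltnS => sf.
rewrite comp_polyD comp_polyM comp_polyX comp_polyC mulrDr !coefD coefMC !coefMX.
rewrite !coefC /= addr0 [(_ \Po _)`_k]coef_comp_XaddC //.
case: k sf => [|k] sf /=; first by ring.
by rewrite IH // -[k.+2%:R]natr1; ring.
Qed.

Lemma size_poly_diff f h j : (size f <= j.+2)%N -> (size (poly_diff f h) <= j.+1)%N.
Proof.
move=> sf; apply/leq_sizeP => k jk; rewrite coefB coef_comp_XaddC ?subrr //.
exact: leq_trans sf _.
Qed.

Lemma coef_poly_diff f h j : (size f <= j.+2)%N ->
  (poly_diff f h)`_j = j.+1%:R * h * f`_j.+1.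
Proof. by move=> sf; rewrite coefB coef_comp_XaddC_subleading // addrC addKr. Qed.

Definition small_values U f H := (\sum_(0 <= u < U) small H f.[u%:R])%N.

(** After [j] differences a polynomial with coefficient [a] in degree [j] becomes the constant
    [j! * a * h_1 ... h_j]. [H] doubles at each step, as the difference of two values in [[-H, H]]
    lies in [[-2H, 2H]]. *)
Fixpoint difference_count U j (a : F) H : nat :=
  if j is j'.+1 then
    (\sum_(0 <= h < U) difference_count U j' (j'.+1%:R * h%:R * a)%R (2 * H))%N
  else small H a.

(** The square counts pairs [(x, y)] of small values. By symmetry, at the price of the factor 2, one
    may take [x = y + h] with [h >= 0], and then the difference polynomial is small at [y]. *)
Lemma small_values_sqr U f H :
  (small_values U f H ^ 2 <= 2 * \sum_(0 <= h < U) small_values U (poly_diff f h%:R) (2 * H))%N.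
Proof.
pose s u : nat := small H f.[u%:R].
pose T := (\sum_(0 <= x < U) \sum_(0 <= y < U) s x * s y * (y <= x))%N.
have -> : (small_values U f H ^ 2 = \sum_(0 <= x < U) \sum_(0 <= y < U) s x * s y)%N.
  by rewrite -mulnn big_distrlr.
apply: (@leq_trans (2 * T)).
  have TE : T = (\sum_(0 <= x < U) \sum_(0 <= y < U) s x * s y * (x <= y))%N.
    rewrite /T exchange_big; apply: eq_bigr => x _; apply: eq_bigr => y _.
    by rewrite [(s y * s x)%N]mulnC.
  rewrite mul2n -addnn {2}TE /T -big_split /=; apply: leq_sum => x _.
  rewrite -big_split /=; apply: leq_sum => y _.
  rewrite -mulnDr leq_pmulr //.
  by move: (leq_total x y); case: (x <= y)%N; case: (y <= x)%N.
rewrite leq_mul2l /= /T exchange_big /= [leqRHS]exchange_big /= big_nat [leqRHS]big_nat.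
apply: leq_sum => y /andP[_ yU].
rewrite (@big_cat_nat _ _ _ y) ?(ltnW yU) //= big_nat [X in (X + _)%N]big1 ?add0n => [|x /andP[_ xy]]; last first.
  by rewrite leqNgt xy muln0.
rewrite -{1}[y]add0n big_addn [leqRHS](@big_cat_nat _ _ _ (U - y)) ?leq_subr //=.
apply: leq_trans (leq_addr _ _); apply: leq_sum => h _.
rewrite leq_addl muln1 /s.
have -> : (poly_diff f h%:R).[y%:R] = f.[(h + y)%:R] - f.[y%:R].
  rewrite /poly_diff hornerD hornerN horner_comp hornerD hornerX hornerC.
  by rewrite [y%:R + _]addrC -natrD.
case: (boolP (small H f.[(h + y)%:R])) => // sX.
case: (boolP (small H f.[y%:R])) => // sY.
by rewrite small_sub.
Qed.

(** Square, apply the power mean over the increment [h], and use induction on each difference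
    polynomial. The factor [U^j] on the left avoids divisions. *)
Lemma weyl_differencing U j f H : (size f <= j.+1)%N ->
  (small_values U f H ^ (2 ^ j) * U ^ j <= (2 * U) ^ (2 ^ j) * difference_count U j (f`_j)%R H)%N.
Proof.
elim: j f H => [|j IH] f H sf.
  rewrite expn0 !expn1 expn0 muln1 /= [f]size1_polyC // coefC /=.
  rewrite /small_values; under eq_bigr do rewrite hornerC.
  by rewrite sum_nat_const_nat subn0 leq_mul2r leq_pmull ?orbT.
have h1 := small_values_sqr U f H.
rewrite [(2 ^ j.+1)%N]expnS expnM.
have h2 : ((small_values U f H ^ 2) ^ (2 ^ j) <=
   2 ^ (2 ^ j) * (U ^ (2 ^ j - 1) * \sum_(0 <= h < U) small_values U (poly_diff f h%:R) (2 * H) ^ (2 ^ j)))%N.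
  apply: (@leq_trans ((2 * \sum_(0 <= h < U) small_values U (poly_diff f h%:R) (2 * H)) ^ (2 ^ j))).
    by rewrite leq_exp2r // expn_gt0.
  by rewrite expnMn leq_mul2l power_mean_nat orbT.
apply: (@leq_trans (2 ^ (2 ^ j) * (U ^ (2 ^ j) *
   \sum_(0 <= h < U) (small_values U (poly_diff f h%:R) (2 * H) ^ (2 ^ j) * U ^ j)))).
  apply: (leq_trans (leq_mul h2 (leqnn _))).
  have E : (U ^ (2 ^ j) = U * U ^ (2 ^ j - 1))%N by rewrite -expnS subn1 prednK ?expn_gt0.
  rewrite -big_distrl /= E expnS; apply/eq_leq; ring.
rewrite (expnM (2 * U) 2) -mulnn [((2 * U * (2 * U)) ^ _)%N]expnMn {1}expnMn.
rewrite -!mulnA leq_mul2l; apply/orP; right; rewrite leq_mul2l; apply/orP; right.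
rewrite /= big_distrr /=; apply: leq_sum => h _.
apply: leq_trans (IH _ _ (size_poly_diff _ sf)) _.
by rewrite coef_poly_diff.
Qed.

Lemma difference_countE U j a H :
  difference_count U j a H =
  product_count U j (fun m => small (2 ^ j * H) ((j`! * m)%:R * a)).
Proof.
elim: j a H => [|j IH] a H; first by rewrite /= !mul1n mul1r.
rewrite [LHS]/= [RHS]/=; apply: eq_bigr => h _; rewrite IH; apply: eq_product_count => m.
rewrite expnSr -mulnA; congr (small _ _).
by rewrite factS !natrM; ring.
Qed.
End WeylDifferencing.

Lemma prime_dvd_fact p n : prime p -> (p %| n`!)%N -> (p <= n)%N.
Proof.
move=> pp; elim: n => [|n IH]; first by rewrite dvdn1 => /eqP p1; rewrite p1 in pp.
rewrite factS Euclid_dvdM // => /orP[/dvdn_leq|/IH]; first exact.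
exact: leqW.
Qed.

Lemma natr_Fp_eq0 p n : prime p -> (n%:R == 0 :> 'F_p) = (p %| n)%N.
Proof. by move=> pp; rewrite (dvdn_pcharf (pchar_Fp pp)). Qed.

(** As [d < p], the constant [d!] times the leading coefficient is invertible, so its multiples
    spread evenly over the residues. *)
Lemma small_values_bound p d (f : {poly 'F_p}) U T H : prime p -> (d < p)%N ->
  size f = d.+1 -> (0 < U)%N -> (0 < T)%N ->
  (forall m, 0 < m <= U ^ d -> size (divisors m) <= T)%N ->
  (small_values U f H ^ (2 ^ d) * U ^ d <= (2 * U) ^ (2 ^ d) *
     (d * U ^ d.-1 + T ^ d * ((U ^ d %/ p).+1 * (2 * (2 ^ d * H).+1))))%N.
Proof.
move=> pp dp sf U0 T0 HT.
apply: leq_trans (weyl_differencing U H (_ : size f <= d.+1)%N) _; first by rewrite sf.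
rewrite leq_mul2l; apply/orP; right; rewrite difference_countE.
apply: leq_trans (product_count_bound _ U0 T0 HT) _.
rewrite leq_add2l leq_mul2l; apply/orP; right.
apply: leq_trans (@count_small_multiples p (d`!%:R * f`_d) (U ^ d) (2 ^ d * H) pp _).
  by apply: leq_sum => m _; rewrite natrM mulrAC.
rewrite mulf_neq0 //; last by have := lead_coef_eq0 f; rewrite /lead_coef sf -size_poly_eq0 sf /= => ->.
by rewrite natr_Fp_eq0 //; apply: contraL dp => /(prime_dvd_fact pp); rewrite -leqNgt.
Qed.

Section Energy.
Variables (p : nat) (pp : prime p) (f : {poly 'F_p}) (A N V0 v0 : nat).

Definition shifted_value (i : 'I_A) (u : 'I_N) (w : 'I_V0) : 'F_p :=
  ((v0 + w)%:R + f.[u%:R]) / i.+1%:R.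

Definition rep (x : 'F_p) : nat :=
  (\sum_(i < A) \sum_(u < N) \sum_(w < V0) (shifted_value i u w == x))%N.

Lemma sum_rep (R : pzSemiRingType) (G : 'F_p -> R) :
  \sum_x (rep x)%:R * G x = \sum_(i < A) \sum_(u < N) \sum_(w < V0) G (shifted_value i u w).
Proof.
transitivity (\sum_x \sum_(i < A) \sum_(u < N) \sum_(w < V0) (shifted_value i u w == x)%:R * G x).
  apply: eq_bigr => x _; rewrite natr_sum mulr_suml; apply: eq_bigr => i _.
  rewrite natr_sum mulr_suml; apply: eq_bigr => u _.
  by rewrite natr_sum mulr_suml.
rewrite exchange_big; apply: eq_bigr => i _; rewrite exchange_big; apply: eq_bigr => u _.
rewrite exchange_big; apply: eq_bigr => w _.
rewrite (bigD1 (shifted_value i u w)) //= eqxx mul1r big1 ?addr0 // => x nx.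
by rewrite eq_sym (negbTE nx) mul0r.
Qed.

Lemma sum_rep1 : (\sum_x rep x = N * V0 * A)%N.
Proof.
have := sum_rep (fun=> 1%N); rewrite !sum_nat_const !card_ord => E.
rewrite -[RHS](_ : A * (N * (V0 * 1)) = _)%N; last by ring.
by rewrite -E; apply: eq_bigr => x _; rewrite mulr1 natn.
Qed.

(** Nontrivial solutions of the homogeneous equation, over the integers: the possible displacements
    between two solutions of the congruence for [w1], [w2]. *)
Definition prop_pairs (a1 a2 : nat) :=
  [set st : 'I_V0 * 'I_V0 | [&& 0 < st.1, 0 < st.2 & a2 * st.1 == a1 * st.2]%N].

(* Subtracting the solution with the least [w1] makes both coordinates nonnegative,
   and then the congruence is an equality of integers. *)
Lemma linear_congruence_count a1 a2 (c : 'F_p) : (2 * (A * V0) <= p)%N ->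
  (0 < a1 <= A)%N -> (0 < a2 <= A)%N ->
  (\sum_(w1 < V0) \sum_(w2 < V0) (a2%:R * w1%:R - a1%:R * w2%:R == c)%R
     <= 1 + #|prop_pairs a1 a2|)%N.
Proof.
move=> Ap /andP[a10 a1A] /andP[a20 a2A].
pose S := [set w : 'I_V0 * 'I_V0 | a2%:R * w.1%:R - a1%:R * w.2%:R == c].
have -> : (\sum_(w1 < V0) \sum_(w2 < V0) (a2%:R * w1%:R - a1%:R * w2%:R == c)%R = #|S|)%N.
  rewrite pair_bigA -sum1_card [RHS]big_mkcond /=; apply: eq_bigr => w _.
  by rewrite inE; case: (_ == _).
have [->|[w0 w0S]] := set_0Vmem S; first by rewrite cards0.
case: (@arg_minnP _ w0 (fun w => w \in S) (fun w => w.1 : nat) w0S) => -[m1 m2] mS min.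
(* Each product [a * (x - y)] is below [A * V0]. If the second coordinate decreased, a positive
   integer below [2 * (A * V0) <= p] would be divisible by [p]. *)
have eqn w : w \in S -> [/\ m1 <= w.1, m2 <= w.2 & a2 * (w.1 - m1) = a1 * (w.2 - m2)]%N.
  move=> wS; have le1 := min _ wS; move: wS mS; rewrite !inE /= => /eqP <- /eqP E.
  have bnd a (x : 'I_V0) y : (a <= A -> a * (x - y) <= A * V0 - a)%N.
    move=> aA; have := ltn_ord x; have : (x - y <= x)%N by rewrite leq_subr.
    move=> h1 h2; apply: (@leq_trans (a * (V0 - 1))); first by rewrite leq_mul2l; apply/orP; right; lia.
    by rewrite mulnBr muln1 leq_sub2r // leq_mul2r aA orbT.
  have neg (x : 'I_V0) : (0 < V0)%N by apply: leq_ltn_trans (ltn_ord x).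
  have AV : (0 < A * V0)%N by rewrite muln_gt0 (leq_trans a10 a1A) (neg m1).
  have h1 := bnd a2 w.1 m1 a2A.
  case: (leqP m2 w.2) => le2; last first.
    have h2 := bnd a1 m2 w.2 a1A.
    have : (a2 * (w.1 - m1) + a1 * (m2 - w.2))%:R == 0 :> 'F_p.
      rewrite natrD !natrM !natrB ?(ltnW le2) //; apply/eqP.
      transitivity (a2%:R * w.1%:R - a1%:R * w.2%:R - (a2%:R * m1%:R - a1%:R * m2%:R) : 'F_p).
        by ring.
      by rewrite E subrr.
    rewrite natr_Fp_eq0 // => /dvdn_leq dl.
    have : (0 < a1 * (m2 - w.2))%N by rewrite muln_gt0 a10 subn_gt0.
    move: h1 h2 dl AV Ap; move: (a2 * _)%N (a1 * _)%N (A * V0)%N => X Y Z; lia.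
  split => //; have h2 := bnd a1 w.2 m2 a1A.
  have : (a2 * (w.1 - m1))%:R == (a1 * (w.2 - m2))%:R :> 'F_p.
    rewrite !natrM !natrB // -subr_eq0; apply/eqP.
    transitivity (a2%:R * w.1%:R - a1%:R * w.2%:R - (a2%:R * m1%:R - a1%:R * m2%:R) : 'F_p).
      by ring.
    by rewrite E subrr.
  move/eqP/(congr1 (fun z : 'F_p => val z)); rewrite /= !val_Fp_nat // !modn_small //.
    by move: h2 AV Ap; move: (a1 * _)%N (A * V0)%N => X Z; lia.
  by move: h1 AV Ap; move: (a2 * _)%N (A * V0)%N => X Z; lia.
rewrite (cardsD1 (m1, m2)) mS leq_add2l.
pose g (w : 'I_V0 * 'I_V0) : 'I_V0 * 'I_V0 :=
  (Ordinal (leq_ltn_trans (leq_subr m1 w.1) (ltn_ord w.1)),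
   Ordinal (leq_ltn_trans (leq_subr m2 w.2) (ltn_ord w.2))).
have inj : {in S :\ (m1, m2) &, injective g}.
  move=> [x1 x2] [y1 y2]; rewrite !in_setD1 => /andP[_ /eqn/= [l1 l2 _]] /andP[_ /eqn/= [l3 l4 _]].
  case=> e1 e2; congr (_, _); apply: val_inj => /=; lia.
rewrite -(card_in_imset inj); apply/subset_leq_card/subsetP => st /imsetP[w].
rewrite in_setD1 => /andP[nw /eqn[l1 l2 e]] ->; rewrite inE /= e eqxx andbT.
have : (w.1 - m1 != 0)%N || (w.2 - m2 != 0)%N.
  apply: contraR nw; rewrite negb_or !negbK => /andP[/eqP z1 /eqP z2].
  case: w l1 l2 {e} z1 z2 => w1 w2 /= l1 l2 z1 z2.
  by apply/eqP; congr (_, _); apply: val_inj => /=; lia.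
rewrite -!lt0n; have : (0 < a2 * (w.1 - m1))%N = (0 < a1 * (w.2 - m2))%N by rewrite e.
by rewrite !muln_gt0 a10 a20 /= => ->; rewrite orbb => ->.
Qed.

(** For fixed [a2] and [s], the equation [a1 * t = a2 * s] factors a known positive integer, which
    leaves at most [T] choices for [a1] and [t] together. *)
Lemma sum_prop_pairs T : (0 < V0)%N ->
  (forall m, 0 < m <= A * V0 -> size (divisors m) <= T)%N ->
  (\sum_(i1 < A) \sum_(i2 < A) #|prop_pairs i1.+1 i2.+1| <= A * V0 * T)%N.
Proof.
move=> V00 HT.
have cardE (i1 i2 : 'I_A) : (#|prop_pairs i1.+1 i2.+1| =
    \sum_(s < V0) \sum_(t < V0) [&& 0 < s, 0 < t & i2.+1 * s == i1.+1 * t])%N.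
  rewrite pair_bigA -sum1_card [LHS]big_mkcond /=; apply: eq_bigr => w _.
  by rewrite inE; case: [&& _, _ & _].
under eq_bigr => i1 _ do under eq_bigr => i2 _ do rewrite cardE.
rewrite exchange_big /=.
apply: (@leq_trans (\sum_(i2 < A) \sum_(s < V0) T)%N); last first.
  by rewrite !sum_nat_const !card_ord mulnA.
apply: leq_sum => i2 _; rewrite exchange_big /=; apply: leq_sum => s _.
case: (posnP s) => [->|s0].
  by rewrite big1 // => i1 _; rewrite big1.
have M0 : (0 < i2.+1 * s)%N by rewrite muln_gt0.
apply: (@leq_trans (size (divisors (i2.+1 * s)))); last first.
  by apply: HT; rewrite M0 leq_mul // ltnW.
apply: leq_trans (sum_mul_eq_le A.+1 V0 M0).
rewrite big_add1 /= big_mkord; apply: leq_sum => i1 _.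
rewrite -(big_mkord predT (fun t => (0 < t) && (i2.+1 * s == i1.+1 * t) : nat)%N).
rewrite [leqLHS]big_ltn //= add0n.
rewrite big_nat [leqRHS]big_nat; by apply: leq_sum => t /andP[-> _]; rewrite /= eq_sym.
Qed.

(** For given [a1], [a2], [u1] at most [kappa] values of [u2] are possible, and each admits one
    solution [w1], [w2] plus its displacements. [A^2] comes from the former, [A * V0 * T] from the
    displacements. *)
Lemma energy_bound kappa T : (0 < V0)%N -> (2 * (A * V0) <= p)%N -> (A < p)%N ->
  (forall m, 0 < m <= A * V0 -> size (divisors m) <= T)%N ->
  (forall (a c : 'F_p), a != 0%R -> small_values N (a *: f - c%:P)%R (A * V0) <= kappa)%N ->
  (\sum_x rep x ^ 2 <= N * kappa * (A ^ 2 + A * V0 * T))%N.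
Proof.
move=> V00 Ap Ap' HT Hk.
have a0 (i : 'I_A) : i.+1%:R != 0 :> 'F_p.
  by rewrite natr_Fp_eq0 //; apply/negP => /(dvdn_leq (ltn0Sn i)); rewrite leqNgt (leq_ltn_trans (ltn_ord i)).
have -> : (\sum_x rep x ^ 2 = \sum_(i1 < A) \sum_(u1 < N) \sum_(w1 < V0) rep (shifted_value i1 u1 w1))%N.
  by rewrite -(sum_rep (fun x => rep x)); apply: eq_bigr => x _; rewrite natn.
apply: (@leq_trans (\sum_(i1 < A) \sum_(u1 < N) \sum_(i2 < A)
    kappa * (1 + #|prop_pairs i1.+1 i2.+1|))%N); last first.
  rewrite exchange_big /= sum_nat_const card_ord -mulnA leq_mul2l; apply/orP; right.
  under eq_bigr do rewrite -big_distrr /=.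
  rewrite -big_distrr /= leq_mul2l; apply/orP; right.
  under eq_bigr do rewrite big_split /=.
  rewrite big_split /= !sum_nat_const card_ord muln1 mulnn leq_add2l.
  exact: sum_prop_pairs.
apply: leq_sum => i1 _; apply: leq_sum => u1 _; rewrite exchange_big /=.
apply: leq_sum => i2 _; rewrite exchange_big /=.
pose a1 : 'F_p := i1.+1%:R; pose a2 : 'F_p := i2.+1%:R.
(* Clearing denominators gives [a2 * w1 - a1 * w2 = a1 * f(u2) - c], whose left side is a difference
   of integers at most [A * V0]. *)
pose c := a2 * f.[u1%:R] + a2 * v0%:R - a1 * v0%:R.
apply: (@leq_trans (\sum_(u2 < N) small (A * V0) (a1 *: f - c%:P).[u2%:R]
    * (1 + #|prop_pairs i1.+1 i2.+1|))%N); last first.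
  rewrite -big_distrl /= leq_mul2r; apply/orP; right.
  by have := Hk a1 c (a0 i1); rewrite /small_values big_mkord.
apply: leq_sum => u2 _.
have eqE (w1 w2 : 'I_V0) : (shifted_value i2 u2 w2 == shifted_value i1 u1 w1) =
    (i2.+1%:R * w1%:R - i1.+1%:R * w2%:R == (a1 *: f - c%:P).[u2%:R]).
  rewrite /shifted_value eqr_div ?a0 // !hornerE /c /a1 /a2 !natrD -subr_eq0 -[RHS]subr_eq0.
  by rewrite -[RHS]oppr_eq0; congr (_ == 0); ring.
under eq_bigr => w1 _ do under eq_bigr => w2 _ do rewrite eqE.
case: (boolP (small _ _)) => [_|ns].
  rewrite mul1n; apply: linear_congruence_count => //; rewrite /= ltn_ord //.
rewrite mul0n leqn0 big1 // => w1 _; rewrite big1 // => w2 _.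
case: eqP => // E; case/negP: ns; rewrite -E -!natrM; apply: small_natB.
  by rewrite leq_mul // ltnW.
by rewrite leq_mul // ltnW.
Qed.

End Energy.

(** * Shifted sums *)

Section ComplexNorm.
Variable R : rcfType.

Lemma normc_ge0 (z : R[i]) : 0 <= Normc.normc z.
Proof. by rewrite -lecR -[(Normc.normc z)%:C%C]/`|z| normr_ge0. Qed.

Lemma normc_sum (I : Type) (s : seq I) (P : pred I) (f : I -> R[i]) :
  Normc.normc (\sum_(i <- s | P i) f i) <= \sum_(i <- s | P i) Normc.normc (f i).
Proof. by rewrite -lecR rmorph_sum; exact: (ler_norm_sum s f P). Qed.

Lemma normc_nat n : Normc.normc (n%:R : R[i]) = n%:R.
Proof. by apply: complexI; rewrite rmorph_nat -[RHS](ger0_norm (ler0n _ _)). Qed.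
End ComplexNorm.

Lemma convex_nat_interval (Q : pred nat) m n : (m <= n)%N ->
  (forall x y z, m <= x <= y -> y <= z < n -> Q x -> Q z -> Q y)%N ->
  exists x y, (m <= x <= y)%N /\ (y <= n)%N /\ (forall v, (m <= v < n)%N -> Q v = (x <= v < y)%N).
Proof.
elim: n => [|n IH] mn H.
  by exists m, m; split; [lia | split => // v; lia].
have [->|] := eqVneq m n.+1.
  by exists n.+1, n.+1; split; [lia | split => // v; lia].
move=> neq; have mn' : (m <= n)%N by lia.
have [|x [y [mxy [yn E]]]] := IH mn'.
  by move=> x y z h1 h2; apply: H => //; lia.
have [Qn|nQn] := boolP (Q n); last first.
  exists x, y; split => //; split; first by lia.
  move=> v vn; have [->|vn'] := eqVneq v n; first by rewrite (negbTE nQn); lia.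
  by apply: E; lia.
have [xy|xy] := ltnP x y; last first.
  exists n, n.+1; split; first by lia.
  split => // v vn; have [->|vn'] := eqVneq v n; first by rewrite Qn; lia.
  by rewrite E; lia.
exists x, n.+1; split; first by lia.
split => // v vn; have [->|vn'] := eqVneq v n; first by rewrite Qn; lia.
have [yv|yv] := leqP y v; last by rewrite E; lia.
rewrite (_ : (x <= v < n.+1)%N); last by lia.
by apply: (H x v n) => //; [lia | lia | rewrite E; lia].
Qed.

Lemma big_convex_nat (V : nmodType) (Q : pred nat) m n :
  (forall x y z, m <= x <= y -> y <= z < n -> Q x -> Q z -> Q y)%N ->
  exists x y, (x <= y)%N /\ forall G : nat -> V,
    \sum_(m <= v < n | Q v) G v = \sum_(x <= v < y) G v.
Proof.
move=> H; have [mn|nm] := leqP m n; last first.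
  by exists 0%N, 0%N; split => // G; rewrite !big_geq // ltnW.
have [x [y [/andP[mx xy] [yn E]]]] := convex_nat_interval mn H.
exists x, y; split => // G; rewrite big_mkcond /=.
rewrite (@big_cat_nat _ _ _ x) //=; last by lia.
rewrite (@big_cat_nat _ _ _ y x) //=.
rewrite big_nat big1 ?add0r => [|v hv]; last by rewrite E; [rewrite ifF //; lia | lia].
rewrite [X in _ + X]big_nat [X in _ + X]big1 ?addr0 => [|v hv]; last by rewrite E; [rewrite ifF //; lia | lia].
by apply: eq_big_nat => v hv; rewrite E; [rewrite hv | lia].
Qed.

Section Burgess.
Variables (R : rcfType) (p : nat) (pp : prime p) (chi : 'F_p -> R[i]).
Hypothesis archi : forall x : R, exists n : nat, x < n%:R.
Hypotheses (chi0 : chi 0 = 0) (chi1 : chi 1 = 1).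
Hypothesis chiM : forall x y, chi (x * y) = chi x * chi y.
Hypothesis chi_np : exists2 x, x != 0 & chi x != 1.

Local Notation normc := (@Normc.normc R).

Lemma normc_chi_le1 x : normc (chi x) <= 1.
Proof. by rewrite -lecR; exact: (norm_chi_le1 chi0 chi1 chiM x). Qed.

Lemma normc_chi x : x != 0 -> normc (chi x) = 1.
Proof. by move=> x0; apply: complexI; exact: (norm_chi chi1 chiM x0). Qed.

(** Each unit shift drops one term and adds one, at a cost of 2. *)
Lemma sum_shift_le (g : nat -> R[i]) (x y s : nat) : (forall v, normc (g v) <= 1) -> (x <= y)%N ->
  normc (\sum_(x <= v < y) g v - \sum_(x <= v < y) g (v + s)%N) <= (2 * s)%:R.
Proof.
move=> g1 xy; elim: s => [|s IH].
  rewrite muln0; under [X in _ - X]eq_bigr do rewrite addn0.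
  by rewrite subrr Normc.normc0.
have -> : \sum_(x <= v < y) g v - \sum_(x <= v < y) g (v + s.+1)%N =
    \sum_(x <= v < y) g v - \sum_(x <= v < y) g (v + s)%N +
    (\sum_(x <= v < y) g (v + s)%N - \sum_(x <= v < y) g (v + s.+1)%N).
  by rewrite addrA subrK.
apply: (le_trans (le_normcD _ _)); rewrite mulnS addnC natrD.
apply: lerD => //.
have -> : \sum_(x <= v < y) g (v + s)%N - \sum_(x <= v < y) g (v + s.+1)%N =
    - (g (y + s)%N - g (x + s)%N).
  rewrite -(telescope_sumr (fun v => g (v + s)%N) xy) -sumrB -sumrN.
  by apply: eq_bigr => v _; rewrite opprB addnS addSn.
rewrite normcN; apply: (le_trans (le_normcD _ _)); rewrite normcN.
by rewrite (natrD _ 1 1) lerD.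
Qed.

Definition short_sum B (x : 'F_p) : R := normc (\sum_(b < B) chi (x + b.+1%:R)).

Lemma short_sum_ge0 B x : 0 <= short_sum B x.
Proof. exact: normc_ge0. Qed.

Lemma short_sum_moment B r : (2 < p)%N -> (0 < r)%N -> (B < p)%N ->
  \sum_x short_sum B x ^+ (2 * r) <=
    (r ^ (2 * r) * B ^ r * p)%:R + (2 * r * B ^ (2 * r))%:R * Num.sqrt p%:R.
Proof.
move=> p2 r0 Bp.
have archiC (x : R[i]) : exists n : nat, `|x| < n%:R.
  by have [n hn] := archi (normc x); exists n; rewrite -(rmorph_nat (real_complex R)) ltcR.
have := burgess_moment pp archiC chi0 chi1 chiM chi_np p2 r0 Bp.
have -> : sqrtC p%:R = (Num.sqrt p%:R)%:C%C :> R[i].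
  rewrite -[LHS](_ : sqrtC ((Num.sqrt p%:R)%:C%C ^+ 2) = _); last first.
    by rewrite -rmorphXn /= sqr_sqrtr ?ler0n // rmorph_nat.
  by rewrite sqrCK // (lecR 0) sqrtr_ge0.
move=> h; rewrite -lecR.
have -> : ((r ^ (2 * r) * B ^ r * p)%:R + (2 * r * B ^ (2 * r))%:R * Num.sqrt p%:R : R)%:C%C =
    (r ^ (2 * r) * B ^ r * p)%:R + (2 * r * B ^ (2 * r))%:R * (Num.sqrt p%:R)%:C%C :> R[i].
  rewrite (rmorphD (real_complex R)) (rmorphM (real_complex R)).
  by rewrite !(rmorph_nat (real_complex R)).
apply: le_trans h; rewrite (rmorph_sum (real_complex R)) le_eqVlt; apply/orP; left; apply/eqP.
by apply: eq_bigr => x _; rewrite (rmorphXn (real_complex R)).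
Qed.

Section ShiftedSums.
Variables (f : {poly 'F_p}) (A B N V0 v0 : nat) (Q : nat -> pred nat).
Hypothesis convexQ : forall u x y z, (v0 <= x <= y)%N -> (y <= z < v0 + V0)%N ->
  Q u x -> Q u z -> Q u y.
Hypothesis Ap : (A < p)%N.

Definition window_sum u : R[i] := \sum_(v0 <= v < v0 + V0 | Q u v) chi (v%:R + f.[u%:R]).

Lemma normc_sum_shifts (i : 'I_A) (u : 'I_N) (w : 'I_V0) :
  normc (\sum_(b < B) chi ((v0 + w + i.+1 * b.+1)%:R + f.[u%:R])) =
  short_sum B (shifted_value f v0 i u w).
Proof.
have i0 : i.+1%:R != 0 :> 'F_p.
  by rewrite natr_Fp_eq0 //; apply/negP => /(dvdn_leq (ltn0Sn i)); rewrite leqNgt (leq_ltn_trans (ltn_ord i)).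
rewrite /short_sum -[RHS]mul1r -(normc_chi i0) -Normc.normcM mulr_sumr; congr (normc _).
apply: eq_bigr => b _; rewrite -chiM; congr (chi _).
rewrite /shifted_value mulrDr mulrCA divff // mulr1 natrD natrM; ring.
Qed.

(** Convexity makes the range of [v] an interval, so each of the [A * B] shifts by [a * b] costs at
    most [2 * A * B]. *)
Lemma window_sum_le (u : 'I_N) :
  (A * B)%:R * normc (window_sum u) <=
    \sum_(i < A) \sum_(w < V0) short_sum B (shifted_value f v0 i u w) + (2 * (A * B) ^ 2)%:R.
Proof.
have [x [y [xy EQ]]] := @big_convex_nat R[i] (Q u) v0 (v0 + V0) (@convexQ u).
pose g v : R[i] := chi (v%:R + f.[u%:R]).
have g1 v : normc (g v) <= 1 by exact: normc_chi_le1.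
have ABE : (A * B)%:R * window_sum u =
    \sum_(i < A) \sum_(b < B) \sum_(v0 <= v < v0 + V0 | Q u v) g (v + i.+1 * b.+1)%N +
    \sum_(i < A) \sum_(b < B) (window_sum u - \sum_(v0 <= v < v0 + V0 | Q u v) g (v + i.+1 * b.+1)%N).
  rewrite -big_split /=; under eq_bigr do rewrite -big_split /=.
  rewrite (eq_bigr (fun=> \sum_(b < B) window_sum u)) => [|i _].
    by rewrite !sumr_const !card_ord -mulrnA mulr_natl mulnC.
  by apply: eq_bigr => b _; rewrite addrC subrK.
rewrite -[(A * B)%:R]normc_nat -Normc.normcM ABE; apply: (le_trans (le_normcD _ _)).
apply: lerD.
  apply: (le_trans (normc_sum _ _ _)); apply: ler_sum => i _.
  rewrite exchange_big /=; apply: (le_trans (normc_sum _ _ _)).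
  apply: (@le_trans _ _ (\sum_(v0 <= v < v0 + V0) normc (\sum_(b < B) g (v + i.+1 * b.+1)%N))).
    rewrite big_mkcond; apply: ler_sum => v _; case: ifP => // _; exact: normc_ge0.
  rewrite -{1}[v0]add0n big_addn addKn big_mkord; apply: ler_sum => w _.
  by rewrite -normc_sum_shifts [(w + v0)%N]addnC.
apply: (le_trans (normc_sum _ _ _)).
apply: (@le_trans _ _ (\sum_(i < A) \sum_(b < B) (2 * (A * B))%:R)).
  apply: ler_sum => i _; apply: (le_trans (normc_sum _ _ _)); apply: ler_sum => b _.
  rewrite /window_sum EQ EQ; apply: (le_trans (sum_shift_le _ g1 xy)).
  by rewrite ler_nat leq_mul2l /= leq_mul.
rewrite !sumr_const !card_ord -mulrnA -[leLHS]mulr_natr -natrM ler_nat; apply/eq_leq; ring.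
Qed.

Definition weighted_short_sums := \sum_x (rep f A N V0 v0 x)%:R * short_sum B x.

Lemma sum_window_sum_le :
  (A * B)%:R * \sum_(u < N) normc (window_sum u) <=
    weighted_short_sums + (N * (2 * (A * B) ^ 2))%:R.
Proof.
rewrite mulr_sumr; apply: (le_trans (ler_sum _ (fun u _ => window_sum_le u))).
rewrite big_split /= /weighted_short_sums sum_rep exchange_big /= sumr_const card_ord.
by rewrite -[_%:R *+ N]mulr_natl -natrM.
Qed.

Lemma weighted_short_sums_ge0 : 0 <= weighted_short_sums.
Proof. by apply: sumr_ge0 => x _; rewrite mulr_ge0 ?ler0n ?short_sum_ge0. Qed.

(** The power mean with weights [rep] and exponent [2^rho], then Cauchy-Schwarz, which separates the
    energy from the moment. *)
Lemma weighted_short_sums_power rho :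
  weighted_short_sums ^+ (2 * 2 ^ rho) <=
    (N * V0 * A)%:R ^+ (2 * 2 ^ rho - 2) * (\sum_x rep f A N V0 v0 x ^ 2)%N%:R *
    \sum_x short_sum B x ^+ (2 * 2 ^ rho).
Proof.
set M : 'F_p -> nat := rep f A N V0 v0; set r := (2 ^ rho)%N.
have r0 : (0 < r)%N by rewrite expn_gt0.
have h1 := @weighted_power_mean R _ (fun x => (M x)%:R) (short_sum B) rho
  (fun x => ler0n _ _) (short_sum_ge0 B).
rewrite -/r -natr_sum sum_rep1 in h1.
have h2 := cauchy_schwarz_sum (fun x => (M x)%:R) (fun x => short_sum B x ^+ r).
rewrite mulnC exprM.
apply: (@le_trans _ _ (((N * V0 * A)%:R ^+ (r - 1) * \sum_x (M x)%:R * short_sum B x ^+ r) ^+ 2)).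
  rewrite ler_pXn2r // nnegrE; first by rewrite exprn_ge0 // weighted_short_sums_ge0.
  rewrite mulr_ge0 ?exprn_ge0 ?ler0n ?sumr_ge0 // => x _.
  by rewrite mulr_ge0 ?exprn_ge0 ?ler0n ?short_sum_ge0.
rewrite exprMn -exprM mulnBl.
rewrite -mulrA; apply: ler_wpM2l; first by rewrite exprn_ge0 ?ler0n.
rewrite natr_sum; under eq_bigr do rewrite natrX.
apply: (le_trans h2); apply: ler_wpM2l; first by apply: sumr_ge0 => x _; exact: sqr_ge0.
by apply: ler_sum => x _; rewrite exprM.
Qed.

End ShiftedSums.
End Burgess.

(** * Choice of parameters *)

(* [q x] stands for [p `^ x]. *)
Section ExponentialParameters.
Variables (R : realFieldType) (p : nat) (q : R -> R).
Hypotheses (qD : forall x y, q (x + y) = q x * q y) (q_gt0 : forall x, 0 < q x).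
Hypotheses (q_le : forall x y, x <= y -> q x <= q y) (q1 : q 1 = p%:R).

Lemma exponential0 : q 0 = 1.
Proof. by apply: (mulfI (lt0r_neq0 (q_gt0 0))); rewrite -qD addr0 mulr1. Qed.

Lemma exponentialX x n : q x ^+ n = q (n%:R * x).
Proof.
elim: n => [|n IH]; first by rewrite mul0r exponential0.
by rewrite exprS IH -qD -natr1; congr q; ring.
Qed.

Lemma exponentialN x : q x * q (- x) = 1.
Proof. by rewrite -qD subrr exponential0. Qed.

Lemma exponential_ge1 x : 0 <= x -> 1 <= q x.
Proof. by move=> x0; rewrite -exponential0 q_le. Qed.

(** Since [N^d >= p], the divisor factor, the range over [p] and the interval contribute
    [N^d * p^(1/6 - 1 + 1/2)] up to a constant. For [d >= 3] this is at most [N^d * p^(-1/d)], the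
    size also allowed to the tuples with a zero factor. The [2^d]-th root gives the exponent
    [1 / (d * 2^d)]. *)
Lemma small_values_saving (d K N U T H : nat) (CT theta : R) :
  (K ^ (2 ^ d) * N ^ d <= (2 * N) ^ (2 ^ d) *
     (d * N ^ d.-1 + T ^ d * ((N ^ d %/ p).+1 * (2 * (2 ^ d * H).+1))))%N ->
  (3 <= d)%N -> (0 < p)%N -> N = U.+1 -> (0 < U)%N -> q d%:R^-1 <= U%:R ->
  T%:R <= CT * q theta -> d%:R * theta <= 6^-1 -> 1 <= CT -> H%:R <= q 2^-1 ->
  K%:R <= 4 * (d%:R + CT ^+ d * 2 ^+ (d + 3)) * U%:R * q (- (d * 2 ^ d)%:R^-1).
Proof.
move=> + d3 p0 NU U0 qU TC dth CT1 Hq.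
set D := (2 ^ d)%N; set S := (d * _ + _)%N; set C2 := d%:R + _.
have D0 : (0 < D)%N by rewrite expn_gt0.
have d0 : 0 < d%:R :> R by rewrite ltr0n; lia.
have U0r : 0 < U%:R :> R by rewrite ltr0n.
have CT0 : 0 <= CT by lra.
have NU2 : N%:R <= 2 * U%:R :> R by rewrite -natrM ler_nat NU mul2n -addnn -addn1 leq_add2l.
have UN : U%:R <= N%:R :> R by rewrite ler_nat NU.
have N0 : 0 < N%:R :> R by rewrite ltr0n NU.
have C21 : 1 <= C2.
  rewrite /C2 (@le_trans _ _ d%:R) ?lerDl ?mulr_ge0 ?exprn_ge0 // ler1n.
  exact: leq_trans _ d3.
have q1d : q 1 = q d%:R^-1 ^+ d by rewrite exponentialX divff // lt0r_neq0.
have pN : (p <= N ^ d)%N.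
  rewrite -(ler_nat R) natrX -q1 q1d.
  apply: lerXn2r; rewrite ?nnegrE ?(ltW (q_gt0 _)) ?(ltW N0) //; exact: le_trans qU UN.
have Nd0 : 0 < N%:R ^+ d :> R by rewrite exprn_gt0.
have S_le : S%:R <= N%:R ^+ d * (C2 * q (- d%:R^-1)).
  rewrite /S natrD /C2 mulrDl mulrDr; apply: lerD.
    rewrite natrM natrX -[in leRHS](@prednK d) ?(leq_trans _ d3) // exprSr.
    have h : 1 <= N%:R * q (- d%:R^-1).
      rewrite -[leLHS](exponentialN d%:R^-1); apply: ler_wpM2r; [exact: ltW | exact: le_trans qU UN].
    rewrite [leRHS](_ : _ = d%:R * N%:R ^+ d.-1 * (N%:R * q (- d%:R^-1))); last by rewrite prednK ?(leq_trans _ d3) //; ring.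
    by rewrite ler_peMr // mulr_ge0 ?exprn_ge0 // ltW.
  have h1 : (T ^ d)%:R <= CT ^+ d * q 6^-1.
    rewrite natrX; apply: (@le_trans _ _ ((CT * q theta) ^+ d)).
      by apply: lerXn2r => //; rewrite nnegrE ?ler0n // mulr_ge0 // ltW.
    by rewrite exprMn exponentialX; apply: ler_wpM2l; [exact: exprn_ge0 | exact: q_le].
  have h2 : (N ^ d %/ p).+1%:R <= 2 * N%:R ^+ d * q (- 1).
    have : ((N ^ d %/ p).+1 * p <= 2 * N ^ d)%N.
      by rewrite mulSn mul2n -addnn leq_add // leq_trunc_div.
    rewrite -(ler_nat R) !natrM natrX -q1 => h.
    by rewrite -[leLHS]mulr1 -[X in _ * X](exponentialN 1) mulrA; apply: ler_wpM2r; first exact: ltW.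
  have h3 : (2 * (2 ^ d * H).+1)%:R <= 2 ^+ (d + 2) * q 2^-1.
    have qh : 1 <= q 2^-1 by apply: exponential_ge1; rewrite invr_ge0 ler0n.
    have h : ((2 ^ d * H).+1 <= 2 ^ d * H.+1)%N.
      by rewrite mulnS -[(2 ^ d * H).+1]add1n leq_add2r expn_gt0.
    apply: (@le_trans _ _ (2 * 2 ^ d * H.+1)%:R); first by rewrite ler_nat -mulnA leq_mul2l h.
    rewrite natrM natrM natrX exprD expr2 -[H.+1%:R]natr1.
    rewrite [leRHS](_ : _ = 2 * 2 ^+ d * (2 * q 2^-1)); last by ring.
    apply: ler_wpM2l; first by apply: mulr_ge0; [exact: ler0n | apply: exprn_ge0; exact: ler0n].
    by rewrite mulr_natl mulr2n lerD.
  rewrite natrM [(_.+1 * _)%:R]natrM.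
  apply: (@le_trans _ _ (CT ^+ d * q 6^-1 * (2 * N%:R ^+ d * q (- 1) * (2 ^+ (d + 2) * q 2^-1)))).
    apply: ler_pM; rewrite ?ler0n //; last by apply: ler_pM; rewrite ?ler0n.
    by rewrite mulr_ge0 ?ler0n.
  rewrite (_ : _ * _ = N%:R ^+ d * (CT ^+ d * (2 * 2 ^+ (d + 2))) * (q 6^-1 * q (- 1) * q 2^-1)); last by ring.
  rewrite -exprS -addnS -!qD [leRHS]mulrA.
  apply: ler_wpM2l; first by rewrite mulr_ge0 ?(ltW Nd0) // mulr_ge0 ?exprn_ge0 ?ler0n.
  apply: q_le; have : d%:R^-1 <= 3^-1 :> R by rewrite lef_pV2 ?posrE ?ler_nat //; lra.
  lra.
move=> hK; have main : K%:R ^+ D <= (2 * N%:R) ^+ D * (C2 * q (- d%:R^-1)).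
  rewrite -(ler_pM2r Nd0); move: hK; rewrite -(ler_nat R) !natrM !natrX natrM => hK.
  apply: (le_trans hK); rewrite -mulrA; apply: ler_wpM2l.
    by rewrite exprn_ge0 // mulr_ge0 ?ler0n.
  by rewrite [leRHS]mulrC.
rewrite -(@ler_pXn2r _ D) ?nnegrE ?ler0n //; last first.
  by rewrite !mulr_ge0 ?ler0n ?(ltW (q_gt0 _)) // (le_trans ler01).
apply: (le_trans main); rewrite !exprMn exponentialX mulrA.
have -> : D%:R * - (d * D)%:R^-1 = - d%:R^-1 :> R.
  by rewrite natrM invfM mulrN mulrCA divff ?mulr1 // pnatr_eq0 -lt0n.
apply: ler_wpM2r; first exact: ltW.
rewrite -exprMn [leRHS]mulrAC; apply: ler_pM; rewrite ?exprn_ge0 ?mulr_ge0 ?ler0n //; first exact: le_trans ler01 C21.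
  by rewrite -exprMn lerXn2r ?nnegrE ?mulr_ge0 ?ler0n //; lra.
by rewrite -[leLHS]expr1 ler_weXn2l.
Qed.

(** Since [B^r >= p^(1/2)], the moment is at most [C3 * B^(2r) * p^(1/2)]; the energy is of order
    [N^2 * A * V0 * p^(theta - eta)], and [A * V0] is at least half of [p^(1/2 - 5 delta - 1/(2r))].
    So [eta] has to cover [theta], [1/(2r)], [delta * (5 + 6 r)] and the constants, a quarter
    each. *)
Lemma burgess_saving (r A B N V0 kappa T En : nat) (X Mo s C1 CT eta theta delta : R) :
  let C3 : R := (r ^ (2 * r) + 2 * r)%N%:R in
  0 <= X -> X ^+ (2 * r) <= (N * V0 * A)%:R ^+ (2 * r - 2) * En%:R * Mo ->
  (En <= N * kappa * (A ^ 2 + A * V0 * T))%N ->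
  Mo <= (r ^ (2 * r) * B ^ r * p)%:R + (2 * r * B ^ (2 * r))%:R * s ->
  0 <= s -> s ^+ 2 = p%:R ->
  kappa%:R <= C1 * N%:R * q (- eta) -> T%:R <= CT * q theta ->
  (A <= V0)%N -> (0 < T)%N -> (0 < r)%N -> (0 < A)%N -> (0 < N)%N -> (0 < B)%N ->
  0 <= C1 -> 0 <= CT ->
  q (4^-1 - delta) <= V0%:R -> q (2 * r%:R)^-1 <= B%:R ->
  q (4^-1 - 4 * delta - (2 * r%:R)^-1) <= 2 * A%:R ->
  theta <= eta / 4 -> (2 * r%:R)^-1 <= eta / 4 -> delta * (5 + 6 * r%:R) = eta / 4 ->
  4 * C1 * CT * C3 <= q (eta / 4) ->
  X <= (N * V0 * A * B)%:R * q (- (3 * delta)).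
Proof.
move=> C3 X0 hX hE hMo s0 s2 hk hT AV T0 r0 A0 N0 B0 C10 CT0 hV hB hA th rh dh big.
have r0r : 0 < r%:R :> R by rewrite ltr0n.
have V00 : (0 < V0)%N by exact: leq_trans A0 AV.
have qh2 : q 2^-1 ^+ 2 = p%:R by rewrite exponentialX divff ?pnatr_eq0.
have sE : s = q 2^-1.
  by apply/eqP; rewrite -(@eqrXn2 _ 2) ?s2 ?qh2 // ltW.
have qr : q 2^-1 <= B%:R ^+ r.
  rewrite (_ : 2^-1 = r%:R * (2 * r%:R)^-1); last by field; lra.
  by rewrite -exponentialX; apply: lerXn2r; rewrite ?nnegrE ?ler0n // ltW.
have C30 : 0 <= C3 by rewrite ler0n.
have Mo_le : Mo <= C3 * (B%:R ^+ (2 * r) * q 2^-1).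
  apply: (le_trans hMo); rewrite sE /C3 natrD mulrDl; apply: lerD.
    rewrite natrM natrM [(B ^ r)%:R]natrX -qh2 expr2 -mulrA; apply: ler_wpM2l; first exact: ler0n.
    rewrite [in leRHS]mulnC exprM expr2 mulrA; apply: ler_wpM2r; first exact: ltW.
    by apply: ler_wpM2l => //; rewrite exprn_ge0 ?ler0n.
  by rewrite natrM natrX mulrA.
have En_le : En%:R <= N%:R * (C1 * N%:R * q (- eta)) * (2 * (A%:R * V0%:R) * (CT * q theta)).
  have : (En <= N * kappa * (2 * (A * V0) * T))%N.
    apply: (leq_trans hE); rewrite leq_mul2l; apply/orP; right.
    have h0 : (A ^ 2 <= A * V0 * T)%N.
      by rewrite -mulnn -mulnA leq_mul2l (leq_trans AV) ?orbT // leq_pmulr.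
    by rewrite -[(2 * _ * T)%N]mulnA mul2n -addnn leq_add2r.
  rewrite -(ler_nat R) => h; apply: (le_trans h); rewrite !natrM.
  apply: ler_pM; rewrite ?mulr_ge0 ?ler0n //.
    by apply: ler_wpM2l; rewrite ?ler0n.
  by apply: ler_wpM2l; rewrite // !mulr_ge0 ?ler0n.
set Y := leRHS.
have Y0 : 0 <= Y by rewrite mulr_ge0 ?ler0n // ltW.
have r20 : (0 < 2 * r)%N by rewrite muln_gt0.
rewrite -(@ler_pXn2r _ (2 * r)) ?nnegrE //.
apply: (le_trans hX).
have YE : Y ^+ (2 * r) = (N * V0 * A)%:R ^+ (2 * r - 2) *
    ((N * V0 * A)%:R ^+ 2 * (B%:R ^+ (2 * r) * q (- (6 * r%:R * delta)))).
  rewrite mulrA -exprD subnK; last by rewrite -{1}[2%N]muln1 leq_mul2l.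
  rewrite /Y natrM !exprMn -mulrA exponentialX; congr (_ * (_ * q _)).
  by rewrite natrM; ring.
rewrite YE -mulrA; apply: ler_wpM2l; first by rewrite exprn_ge0 ?ler0n.
apply: (@le_trans _ _ ((N%:R * (C1 * N%:R * q (- eta)) * (2 * (A%:R * V0%:R) * (CT * q theta))) *
   (C3 * (B%:R ^+ (2 * r) * q 2^-1)))).
  have [Mo0|Mo0] := leP 0 Mo.
    by apply: ler_pM; rewrite ?ler0n.
  apply: (@le_trans _ _ 0); first by rewrite mulr_ge0_le0 ?ler0n // ltW.
  by rewrite !mulr_ge0 ?exprn_ge0 ?ler0n //; exact: ltW.
rewrite !natrM.
set a : R := A%:R; set v : R := V0%:R; set n : R := N%:R; set b := B%:R ^+ _.
have [a0 v0 n0] : [/\ 0 < a, 0 < v & 0 < n] by rewrite /a /v /n !ltr0n.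
have b0 : 0 < b by rewrite exprn_gt0 // ltr0n.
have key : 2 * C1 * CT * C3 * q (- eta + theta + 2^-1) <= a * v * q (- (6 * r%:R * delta)).
  have av : q (2^-1 - 5 * delta - (2 * r%:R)^-1) <= 2 * (a * v).
    rewrite (_ : _ - _ = (4^-1 - 4 * delta - (2 * r%:R)^-1) + (4^-1 - delta)); last by field; lra.
    by rewrite qD mulrA; apply: ler_pM; rewrite ?(ltW (q_gt0 _)).
  have h1 : 4 * C1 * CT * C3 * q (- eta + theta + 2^-1) <= q (eta / 4) * q (- eta + theta + 2^-1).
    by apply: ler_wpM2r => //; exact: ltW.
  have h2 : q (eta / 4) * q (- eta + theta + 2^-1) <=
      q (2^-1 - 5 * delta - (2 * r%:R)^-1) * q (- (6 * r%:R * delta)).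
    rewrite -!qD; apply: q_le.
    have dh' : delta * 5 + 6 * r%:R * delta = eta / 4 by rewrite -dh; ring.
    move: dh' th rh; move: (6 * r%:R * delta) (2 * r%:R)^-1 => y z; lra.
  have h3 : q (2^-1 - 5 * delta - (2 * r%:R)^-1) * q (- (6 * r%:R * delta)) <=
      2 * (a * v) * q (- (6 * r%:R * delta)).
    by apply: ler_wpM2r => //; exact: ltW.
  have h := le_trans h1 (le_trans h2 h3).
  rewrite -(@ler_pM2l _ 2) ?ltr0n // mulrA.
  rewrite [leLHS](_ : _ = 4 * C1 * CT * C3 * q (- eta + theta + 2^-1)); last by ring.
  by rewrite [leRHS](_ : _ = 2 * (a * v) * q (- (6 * r%:R * delta))) //; ring.
rewrite [leLHS](_ : _ = n ^+ 2 * (a * v) * b * (2 * C1 * CT * C3 * (q (- eta) * q theta * q 2^-1))); last by ring.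
rewrite [leRHS](_ : _ = n ^+ 2 * (a * v) * b * (a * v * q (- (6 * r%:R * delta)))); last by ring.
by rewrite -!qD; apply: ler_wpM2l => //; rewrite !mulr_ge0 ?exprn_ge0 // ltW.
Qed.

End ExponentialParameters.

Section ShortSums.
Variables (R : archiRcfType) (p : nat) (pp : prime p) (chi : 'F_p -> R[i]).
Hypotheses (chi0 : chi 0 = 0) (chi1 : chi 1 = 1).
Hypothesis chiM : forall x y, chi (x * y) = chi x * chi y.
Hypothesis chi_np : exists2 x, x != 0 & chi x != 1.
Variable q : R -> R.
Hypotheses (qD : forall x y, q (x + y) = q x * q y) (q_gt0 : forall x, 0 < q x).
Hypotheses (q_le : forall x y, x <= y -> q x <= q y) (q1 : q 1 = p%:R).
Variables (d rho T : nat) (CT eta theta delta : R).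
Let r := (2 ^ rho)%N.
Let C1 := 4 * (d%:R + CT ^+ d * 2 ^+ (d + 3)).
Hypotheses (d3 : (3 <= d)%N) (dp : (d < p)%N) (T0 : (0 < T)%N).
Hypothesis HT : forall m, (0 < m <= p ^ d)%N -> (size (divisors m) <= T)%N.
Hypotheses (TCT : T%:R <= CT * q theta) (CT1 : 1 <= CT).
Hypotheses (etaE : eta = (d * 2 ^ d)%:R^-1) (theta_eta : theta <= eta / 4).
Hypotheses (dtheta : d%:R * theta <= 6^-1) (reta : (2 * r%:R)^-1 <= eta / 4).
Hypotheses (delta_gt0 : 0 < delta) (deltaE : delta * (5 + 6 * r%:R) = eta / 4).
Hypothesis large_const : 4 * C1 * CT * (r ^ (2 * r) + 2 * r)%N%:R <= q (eta / 4).
Hypotheses (large4 : 4 <= q 2^-1) (large2 : 2 <= q (2 * delta)).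
Variables (f : {poly 'F_p}) (U V : nat).
Hypotheses (sf : size f = d.+1) (U0 : (0 < U)%N) (Up : (U < p)%N).
Hypotheses (qU : q d%:R^-1 <= U%:R) (qV : q (4^-1 - delta) <= V%:R).

Local Notation normc := (@Normc.normc R).
Local Notation q_ge1 := (exponential_ge1 qD q_gt0 q_le).

Lemma short_window_bound : exists V0, (0 < V0 <= V)%N /\
  forall v0 (Q : nat -> pred nat),
    (forall u x y z, v0 <= x <= y -> y <= z < v0 + V0 -> Q u x -> Q u z -> Q u y)%N ->
    \sum_(u < U.+1) normc (window_sum chi f V0 v0 Q u) <=
      10 * U%:R * V0%:R * q (- (3 * delta)).
Proof.
have r0 : (0 < r)%N by rewrite expn_gt0.
have r0r : 0 < r%:R :> R by rewrite ltr0n.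
have r0i : 0 < (2 * r%:R)^-1 :> R by rewrite invr_gt0 mulr_gt0.
have eta_le : eta <= 24^-1.
  rewrite etaE lef_pV2 ?posrE ?ltr0n ?muln_gt0 ?expn_gt0 ?(leq_trans _ d3) //.
  by rewrite ler_nat -[24%N]/(3 * 2 ^ 3)%N leq_mul // leq_exp2l.
have delta_eta : delta * 11 <= eta / 4.
  rewrite -deltaE ler_pM2l //; have : 1 <= r%:R :> R by rewrite ler1n.
  lra.
pose alpha := 4^-1 - 4 * delta - (2 * r%:R)^-1 : R.
pose i2r := (2 * r%:R)^-1 : R.
have alpha0 : 0 <= alpha by rewrite /alpha; move: delta_eta reta eta_le; lra.
have x0 : 1 <= q (4^-1 - delta) by apply: q_ge1; move: delta_eta eta_le; lra.
(* [V0] is rounded up but capped at [V]. [B] is rounded up because [B^r >= p^(1/2)] is needed, [A]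
   down because [A * V0] and [A * B] must stay small. The exponent [alpha] makes [A * B] at most
   [2 * V0 * p^(-3 delta)], the error tolerated in shifting. *)
pose V0 := minn V (Num.truncn (q (4^-1 - delta))).+1.
pose B := (Num.truncn (q i2r)).+1.
pose A := Num.truncn (q alpha).
have V0V : (V0 <= V)%N by exact: geq_minl.
have xV0 : q (4^-1 - delta) <= V0%:R.
  by rewrite /V0; case: leqP => // _; exact/ltW/truncnS_gt.
have V0x : V0%:R <= 2 * q (4^-1 - delta).
  apply: (@le_trans _ _ (Num.truncn (q (4^-1 - delta))).+1%:R); first by rewrite ler_nat geq_minr.
  by rewrite -[_.+1%:R]natr1 mulr_natl mulr2n lerD // truncn_le ltW.
have V00 : (0 < V0)%N by rewrite -(ltr0n R); exact: lt_le_trans xV0.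
have qB : q i2r <= B%:R by exact/ltW/truncnS_gt.
have b1 : 1 <= q i2r by apply: q_ge1; exact: ltW.
have Bq : B%:R <= 2 * q i2r.
  by rewrite /B -[_.+1%:R]natr1 mulr_natl mulr2n lerD // truncn_le ltW.
have a1 : 1 <= q alpha by exact: q_ge1.
have Aq : A%:R <= q alpha by rewrite truncn_le ltW.
have A0 : (0 < A)%N by rewrite truncn_gt0.
have qA : q alpha <= 2 * A%:R.
  have : q alpha < A.+1%:R by exact: truncnS_gt.
  have : 1 <= A%:R :> R by rewrite ler1n.
  rewrite -[A.+1%:R]natr1 => h1 h2; apply: ltW; apply: (lt_le_trans h2).
  by rewrite mulr_natl mulr2n lerD2l.
have qh : q 2^-1 ^+ 2 = p%:R by rewrite (exponentialX qD q_gt0) divff ?pnatr_eq0.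
have AV0q : A%:R * V0%:R <= 2 * q (alpha + (4^-1 - delta)).
  apply: (@le_trans _ _ (q alpha * (2 * q (4^-1 - delta)))); first by apply: ler_pM; rewrite ?ler0n.
  by rewrite qD mulrCA.
have AV0p : (2 * (A * V0) <= p)%N.
  rewrite -(ler_nat R) natrM natrM -qh expr2.
  apply: (@le_trans _ _ (4 * q 2^-1)); last by apply: ler_wpM2r => //; exact: ltW.
  have : q (alpha + (4^-1 - delta)) <= q 2^-1.
    by apply: q_le; rewrite /alpha; move: delta_gt0 r0i; lra.
  by move: AV0q; move: (q (alpha + _)) (q 2^-1) (A%:R * _) => a b c; lra.
have AV0h : (A * V0)%:R <= q 2^-1.
  rewrite natrM; apply: (le_trans AV0q).
  apply: (@le_trans _ _ (q (2 * delta) * q (alpha + (4^-1 - delta)))).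
    by apply: ler_wpM2r => //; exact: ltW.
  by rewrite -qD; apply: q_le; rewrite /alpha; move: delta_gt0 r0i; lra.
have Ap : (A < p)%N.
  apply: leq_trans AV0p; rewrite mul2n -addnn -addn1.
  by apply: leq_add; rewrite ?muln_gt0 ?A0 // leq_pmulr.
have p2 : (2 < p)%N by apply: leq_ltn_trans dp; exact: leq_trans d3.
have Bp : (B < p)%N.
  rewrite -(ltr_nat R) -qh expr2; apply: (le_lt_trans Bq).
  apply: (@lt_le_trans _ _ (4 * q 2^-1)); last by apply: ler_wpM2r => //; exact: ltW.
  have : q i2r <= q 2^-1 by apply: q_le; rewrite /i2r; move: reta eta_le; lra.
  by have := q_gt0 2^-1; move: (q i2r) (q 2^-1) => a b; lra.
have AV : (A <= V0)%N.
  rewrite -(ler_nat R); apply: (le_trans Aq); apply: le_trans xV0; apply: q_le.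
  by rewrite /alpha; move: delta_gt0 r0i; lra.
have CT0 : 0 <= CT by exact: le_trans CT1.
have C10 : 0 <= C1.
  by rewrite mulr_ge0 ?addr_ge0 ?ler0n // mulr_ge0 ?exprn_ge0 ?ler0n.
exists V0; split; first by rewrite V00.
move=> v0 Q convexQ; pose N := U.+1.
have Np : (N ^ d <= p ^ d)%N by rewrite leq_exp2r // (leq_trans _ d3).
have HT' m : (0 < m <= A * V0)%N -> (size (divisors m) <= T)%N.
  case/andP => m0 mAV; apply: HT; rewrite m0 /=; apply: (leq_trans mAV).
  have : (p ^ 1 <= p ^ d)%N by rewrite leq_exp2l ?prime_gt1 // (leq_trans _ d3).
  rewrite expn1; apply: leq_trans; apply: leq_trans AV0p.
  by rewrite mul2n -addnn leq_addr.
have k0 : 0 <= C1 * U%:R * q (- eta).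
  by apply: mulr_ge0; [apply: mulr_ge0; [exact: C10 | exact: ler0n] | exact: ltW].
pose kappa := Num.truncn (C1 * U%:R * q (- eta)).
have Hk (a c : 'F_p) : a != 0 -> (small_values N (a *: f - c%:P) (A * V0) <= kappa)%N.
  move=> a0; have sg : size (a *: f - c%:P) = d.+1.
    rewrite size_polyDl size_scale // sf // size_polyN ltnS.
    by apply: (leq_trans (size_polyC_leq1 _)); exact: leq_trans d3.
  rewrite truncn_ge_nat //.
  have hK := small_values_bound (A * V0) pp dp sg (ltn0Sn U) T0
    (fun m h => HT (m := m) (introT andP (conj (proj1 (elimT andP h)) (leq_trans (proj2 (elimT andP h)) Np)))).
  rewrite etaE /C1.
  exact: (small_values_saving qD q_gt0 q_le q1 hK d3 (prime_gt0 pp) erefl U0 qU TCT dtheta CT1 AV0h).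
have kr : kappa%:R <= C1 * N%:R * q (- eta).
  apply: (@le_trans _ _ (C1 * U%:R * q (- eta))).
    by rewrite truncn_le.
  apply: ler_wpM2r; first exact: ltW.
  by apply: ler_wpM2l => //; rewrite ler_nat.
have archi (x : R) : exists n : nat, x < n%:R by exists (Num.truncn x).+1; exact: truncnS_gt.
have HE := energy_bound pp v0 V00 AV0p Ap HT' Hk.
have HMo := short_sum_moment pp archi chi0 chi1 chiM chi_np p2 r0 Bp.
have HX := @weighted_short_sums_power R p chi f A B N V0 v0 rho.
have X0 := @weighted_short_sums_ge0 R p chi f A B N V0 v0.
have sq : Num.sqrt p%:R ^+ 2 = p%:R :> R by rewrite sqr_sqrtr ?ler0n.
have Xle := burgess_saving qD q_gt0 q_le q1 X0 HX HE HMo (sqrtr_ge0 _) sq kr TCT AV T0 r0 A0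
  (ltn0Sn U) (ltn0Sn _) C10 CT0 xV0 qB qA theta_eta reta deltaE large_const.
have := @sum_window_sum_le R p pp chi chi0 chi1 chiM f A B N V0 v0 Q convexQ Ap.
rewrite -/N; set S := \sum_(u < N) _ => hS.
have AB0 : 0 < (A * B)%:R :> R by rewrite ltr0n muln_gt0 A0.
rewrite -(ler_pM2l AB0); apply: (le_trans hS); apply: (le_trans (lerD Xle (lexx _))).
have ABq : (A * B)%:R <= 2 * V0%:R * q (- (3 * delta)).
  rewrite natrM; apply: (@le_trans _ _ (q alpha * (2 * q i2r))); first by apply: ler_pM; rewrite ?ler0n.
  rewrite mulrCA -qD -mulrA; apply: ler_wpM2l; first exact: ler0n.
  rewrite (_ : alpha + i2r = 4^-1 - delta + - (3 * delta)); last by rewrite /alpha /i2r; ring.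
  by rewrite qD; apply: ler_wpM2r => //; exact: ltW.
rewrite !natrM.
have NU : N%:R <= 2 * U%:R :> R by rewrite -natrM ler_nat /N mul2n -addnn -addn1 leq_add2l.
set a : R := A%:R; set b : R := B%:R; set w := q (- (3 * delta)).
have [a0 bb0 w0] : [/\ 0 <= a, 0 <= b & 0 <= w] by split; [exact: ler0n | exact: ler0n | exact/ltW/q_gt0].
rewrite -/a -/b.
have ABq' : a * b <= 2 * V0%:R * w by move: ABq; rewrite natrM.
(* The main term contributes 1 and the shifting error [2 * 2], hence 5; then [N = U + 1 <= 2 * U]
   gives 10. *)
apply: (@le_trans _ _ (a * b * (5 * N%:R * V0%:R * w))).
  have : N%:R * (a * b) * (a * b) <= N%:R * (a * b) * (2 * V0%:R * w).
    by apply: ler_wpM2l => //; rewrite !mulr_ge0 ?ler0n.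
  move=> h.
  rewrite [leLHS](_ : _ = a * b * N%:R * V0%:R * w + 2 * (N%:R * (a * b) * (a * b))); last by ring.
  rewrite [leRHS](_ : _ = a * b * N%:R * V0%:R * w + 2 * (N%:R * (a * b) * (2 * V0%:R * w))); last by ring.
  by rewrite lerD2l; apply: ler_wpM2l; rewrite ?ler0n.
apply: ler_wpM2l; first by rewrite mulr_ge0.
apply: ler_wpM2r => //; apply: ler_wpM2r; first exact: ler0n.
by rewrite (_ : 10 = 5 * 2) -?mulrA ?ler_pM2l ?ltr0n // -natrM.
Qed.

End ShortSums.

(** * Cutting the range of [v] into blocks, and the final estimate *)

Lemma big_nat_blocks (S : nmodType) (L J m : nat) (P : pred nat) (G : nat -> S) :
  \sum_(m <= v < m + J * L | P v) G v =
  \sum_(j < J) \sum_(m + j * L <= v < m + j * L + L | P v) G v.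
Proof.
elim: J => [|J IH]; first by rewrite mul0n addn0 big_geq // big_ord0.
rewrite big_ord_recr /= -IH mulSn addnCA -[(L + _)%N]addnC.
by rewrite (@big_cat_nat _ _ _ (m + J * L)) ?leq_addr.
Qed.

(** The last block may run past [V]; the added condition [v <= V] cuts it and preserves convexity in
    [v]. *)
Lemma big_nat_short_blocks (S : nmodType) (L V : nat) (P : pred nat) (G : nat -> S) :
  (0 < L)%N ->
  \sum_(1 <= v < V.+1 | P v) G v =
  \sum_(j < (V %/ L).+1) \sum_(1 + j * L <= v < 1 + j * L + L | P v && (v <= V)%N) G v.
Proof.
move=> L0; rewrite -big_nat_blocks.
have VL : (V.+1 <= 1 + (V %/ L).+1 * L)%N by rewrite ltnS ltnW // -ltn_divLR.
rewrite [RHS](@big_cat_nat _ _ _ V.+1) //= [X in _ + X]big_nat_cond.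
rewrite [X in _ + X]big1 ?addr0 => [|v /andP[/andP[Vv _] /andP[_]]]; last first.
  by rewrite leqNgt Vv.
rewrite big_nat_cond [RHS]big_nat_cond; apply: eq_bigl => v.
by rewrite ltnS; case: (v <= V)%N; rewrite ?andbT ?andbF.
Qed.

(** The number of blocks [V %/ V0 + 1] is at most [2 * V / V0] because [V0 <= V]. All cancellation
    is in [v], so the weights [alpha u] go out with absolute values. *)
Lemma double_sum_bound (R : rcfType) (p : nat) (chi : 'F_p -> R[i]) (f : {poly 'F_p})
    (U V V0 : nat) (K : R) (Q : nat -> pred nat) (alpha : nat -> R[i]) :
  (0 < V0 <= V)%N -> 0 <= K ->
  (forall v0 (Q : nat -> pred nat),
    (forall u x y z, v0 <= x <= y -> y <= z < v0 + V0 -> Q u x -> Q u z -> Q u y)%N ->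
    \sum_(u < U.+1) Normc.normc (window_sum chi f V0 v0 Q u) <= V0%:R * K) ->
  (forall u x y z, x <= y <= z -> Q u x -> Q u z -> Q u y)%N ->
  (forall u, (1 <= u <= U)%N -> Normc.normc (alpha u) <= 1) ->
  Normc.normc (\sum_(1 <= u < U.+1) \sum_(1 <= v < V.+1 | Q u v)
     alpha u * chi (v%:R + f.[u%:R])) <= 2 * V%:R * K.
Proof.
case/andP => V00 V0V K0 H convexQ alpha1.
pose Q' u v := Q u v && (v <= V)%N; pose J := (V %/ V0).+1.
apply: (@le_trans _ _ (\sum_(1 <= u < U.+1) \sum_(j < J)
    Normc.normc (window_sum chi f V0 (1 + j * V0) Q' u))).
  apply: (le_trans (normc_sum _ _ _)); rewrite big_nat [leRHS]big_nat; apply: ler_sum => u uU.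
  rewrite -mulr_sumr Normc.normcM -[leRHS]mul1r; apply: ler_pM; rewrite ?normc_ge0 ?alpha1 //.
  by rewrite (big_nat_short_blocks _ _ _ V00) normc_sum.
rewrite exchange_big /=; apply: (@le_trans _ _ (\sum_(j < J) V0%:R * K)).
  apply: ler_sum => j _; apply: le_trans (H (1 + j * V0)%N Q' _).
    by rewrite -(big_mkord predT (fun u => Normc.normc (window_sum chi f V0 (1 + j * V0) Q' u)))
         [leRHS]big_ltn // lerDr normc_ge0.
  move=> u x y z /andP[_ xy] /andP[yz _] /andP[Qx xV] /andP[Qz zV]; apply/andP; split.
    by apply: (convexQ u x y z) => //; rewrite xy.
  exact: leq_trans yz zV.
rewrite sumr_const card_ord -[leLHS]mulr_natl mulrA; apply: ler_wpM2r => //.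
by rewrite -!natrM ler_nat /J mulSn mul2n -addnn leq_add // leq_trunc_div.
Qed.

Require Import Defs.
From mathcomp Require Import all_classical all_reals all_analysis.

Lemma large_powR (R : realType) (c M : R) : 0 < c ->
  exists n0 : nat, forall n : nat, (n0 <= n)%N -> M <= n%:R `^ c.
Proof.
move=> c0; pose M' := `|M| + 1.
have M'0 : 0 < M' by rewrite ltr_wpDl.
exists (Num.truncn (M' `^ c^-1)).+1 => n hn.
apply: (@le_trans _ _ M'); first by rewrite (le_trans (ler_norm _)) // lerDl.
have -> : M' = (M' `^ c^-1) `^ c by rewrite -powRrM mulVf ?lt0r_neq0 ?powRr1 ?(ltW M'0).
apply: ge0_ler_powR.
- exact: ltW.
- by rewrite nnegrE powR_ge0.
- by rewrite nnegrE ler0n.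
- by apply/ltW/(lt_le_trans (truncnS_gt _)); rewrite ler_nat.
Qed.

Lemma convex_in_plane_vertical (R : realType) (C : set (R * R)) (u x y z : nat) :
  convex_in_plane C -> (x <= y <= z)%N ->
  (u%:R, x%:R) \in C -> (u%:R, z%:R) \in C -> (u%:R, y%:R) \in C.
Proof.
move=> convexC /andP[xy yz] xC zC.
have [xz|zx] := ltnP x z; last first.
  by rewrite (_ : y = x) //; apply/eqP; rewrite eqn_leq xy (leq_trans yz).
have d0 : 0 < z%:R - x%:R :> R by rewrite subr_gt0 ltr_nat.
pose t : R := (z%:R - y%:R) / (z%:R - x%:R).
have t0 : 0 <= t by rewrite divr_ge0 ?(ltW d0) // subr_ge0 ler_nat.
have t1 : t <= 1 by rewrite ler_pdivrMr // mul1r lerD2l lerN2 ler_nat.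
have E : (t * u%:R + (1 - t) * u%:R, t * x%:R + (1 - t) * z%:R) \in C.
  exact: (convexC _ _ (Itv01 t0 t1) xC zC).
rewrite (_ : (u%:R, y%:R) = (t * u%:R + (1 - t) * u%:R, t * x%:R + (1 - t) * z%:R)) //.
congr (_, _); first by ring.
by rewrite /t; field; exact: lt0r_neq0.
Qed.

Local Open Scope classical_set_scope.
Local Open Scope ring_scope.

Theorem theorem2p6 (R : realType) (d : nat) (eps : R) :
  (3 <= d)%N -> 0 < eps ->
  exists2 delta : R, 0 < delta &
  exists p0 : nat, forall p : nat, prime p -> (p0 <= p)%N ->
  forall chi : 'F_p -> R[i],
    multiplicative_character chi -> nonprincipal chi ->
  forall U V : nat, (1 <= U < p)%N -> (1 <= V < p)%N ->
    p%:R `^ (d%:R^-1 + eps) <= U%:R :> R ->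
    p%:R `^ (4^-1 - delta) <= V%:R :> R ->
  forall C : set (R * R),
    C `<=` `[1, U%:R] `*` `[1, V%:R] -> convex_in_plane C ->
  forall alpha : nat -> R[i],
    (forall u : nat, (1 <= u <= U)%N -> `|alpha u| <= 1) ->
  forall f : {poly 'F_p}, size f = d.+1 ->
    `|sum_integer_points U V C
        (fun u v => alpha u * chi (v%:R + f.[u%:R]))|
      <= (U%:R * V%:R * p%:R `^ (- delta))%:C%C.
Proof.
move=> d3 eps0.
have d0 : (0 < d)%N by exact: leq_trans d3.
have D0 : (0 < 2 ^ d)%N by rewrite expn_gt0.
have dr : 0 < d%:R :> R by rewrite ltr0n.
pose eta : R := (d * 2 ^ d)%:R^-1.
have eta0 : 0 < eta by rewrite invr_gt0 ltr0n muln_gt0 d0.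
(* Chosen so that [k * (eta / 4) = d]: an integer up to [p^d] then has [O(p^(eta/4))] divisors. *)
pose k := (4 * d * (d * 2 ^ d))%N.
have k0 : (0 < k)%N by rewrite !muln_gt0 d0.
(* Then [2 * r = 4 * 2^d * 2^d >= 4 * d * 2^d], that is [1 / (2r) <= eta / 4]. *)
pose rho := (2 * d).+1; pose r := (2 ^ rho)%N.
pose delta : R := eta / (4 * (5 + 6 * r%:R)).
have den0 : 0 < 5 + 6 * r%:R :> R by rewrite ltr_wpDr ?ltr0n // mulr_ge0 ?ler0n.
have delta0 : 0 < delta by rewrite divr_gt0 // mulr_gt0 ?ltr0n.
have [Cd HCd] := size_divisors_bound k0.
(* The [+ 1] ensures [CT >= 1], hence also [Cd <= CT^k]. *)
pose CT : R := Cd%:R + 1.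
have CT1 : 1 <= CT by rewrite lerDr ler0n.
pose C1 := 4 * (d%:R + CT ^+ d * 2 ^+ (d + 3)).
have eta4 : 0 < eta / 4 by rewrite divr_gt0.
have half0 : 0 < 2^-1 :> R by rewrite invr_gt0.
have delta2 : 0 < 2 * delta by rewrite mulr_gt0.
have [n1 Hn1] := large_powR (4 * C1 * CT * (r ^ (2 * r) + 2 * r)%N%:R) eta4.
have [n2 Hn2] := large_powR 4 half0.
(* The constant 20 is 2 from the number of blocks times 10 from each block; [p^(2 delta)] absorbs it
   and turns [p^(-3 delta)] into [p^(-delta)]. *)
have [n3 Hn3] := large_powR 20 delta2.
exists delta => //; exists (maxn d.+1 (maxn n1 (maxn n2 n3))) => p pp.
rewrite !geq_max => /and4P[dp /Hn1 big1 /Hn2 big2 /Hn3 big3].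
move=> chi [chi0 chin0 chiM'] chi_np U V /andP[U0 Up] /andP[V0 Vp] hU hV C _ convexC alpha halpha f sf.
have chi1 : chi 1 = 1.
  have c1 := chin0 1 (oner_neq0 _).
  by apply: (mulfI c1); rewrite -chiM' ?oner_neq0 // !mulr1.
have chiM x y : chi (x * y) = chi x * chi y.
  have [->|x0] := eqVneq x 0; first by rewrite mul0r chi0 mul0r.
  have [->|y0] := eqVneq y 0; first by rewrite mulr0 chi0 mulr0.
  exact: chiM'.
have P1 : 1 <= p%:R :> R by rewrite ler1n prime_gt0.
have P0 : 0 < p%:R :> R by exact: lt_le_trans P1.
pose q (x : R) : R := p%:R `^ x.
have qD x y : q (x + y) = q x * q y by rewrite /q powRD // (lt0r_neq0 P0) implybT.
have q_gt0 x : 0 < q x by exact: powR_gt0.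
have q_le x y : x <= y -> q x <= q y by exact: ler_powR.
have q1 : q 1 = p%:R by rewrite /q powRr1 // ltW.
pose T := Num.truncn (CT * q (eta / 4)).
have CTq : 1 <= CT * q (eta / 4).
  by rewrite -[1]mulr1; apply: ler_pM => //; apply: (exponential_ge1 qD q_gt0 q_le); rewrite divr_ge0 // ltW.
have T0 : (0 < T)%N by rewrite truncn_gt0.
have TCT : T%:R <= CT * q (eta / 4) by rewrite truncn_le (le_trans _ CTq).
have HT m : (0 < m <= p ^ d)%N -> (size (divisors m) <= T)%N.
  case/andP => m0 mp; rewrite truncn_ge_nat; last by rewrite (le_trans _ CTq).
  rewrite -(@ler_pXn2r _ k) ?nnegrE ?ler0n ?(le_trans _ CTq) //.
  rewrite -natrX; apply: (@le_trans _ _ (Cd * p ^ d)%:R).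
    by rewrite ler_nat (leq_trans (HCd m m0)) // leq_mul2l mp orbT.
  rewrite natrM exprMn; apply: ler_pM; rewrite ?ler0n //.
    apply: (@le_trans _ _ CT); first by rewrite lerDl.
    by rewrite -[leLHS]expr1 ler_weXn2l.
  rewrite natrX -q1 !(exponentialX qD q_gt0); apply: q_le.
  rewrite mulr1 /eta /k !natrM le_eqVlt; apply/orP; left; apply/eqP; field.
  by rewrite !pnatr_eq0 -!lt0n d0 D0.
have etad : d%:R * (eta / 4) <= 6^-1.
  rewrite /eta natrM invfM -mulrA mulrA divff ?lt0r_neq0 // mul1r -invfM.
  rewrite -natrM lef_pV2 ?posrE ?ltr0n ?muln_gt0 ?D0 // ler_nat.
  by rewrite (@leq_trans (2 ^ 1 * 4)) // leq_mul2r leq_exp2l.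
have reta : (2 * r%:R)^-1 <= eta / 4.
  rewrite /eta -invfM -!natrM lef_pV2 ?posrE ?ltr0n ?muln_gt0 ?d0 ?D0 ?expn_gt0 // ler_nat.
  rewrite /r /rho expnS mulnA mulnC leq_mul2l /= mul2n -addnn expnD leq_mul2r.
  by apply/orP; right; exact/ltnW/ltn_expl.
have deltaE : delta * (5 + 6 * r%:R) = eta / 4.
  by rewrite /delta; field; rewrite lt0r_neq0.
have two : 2 <= q (2 * delta) by apply: le_trans big3; rewrite ler_nat.
have qU : q d%:R^-1 <= U%:R by apply: le_trans hU; apply: q_le; rewrite lerDl ltW.
have [V0' [V0V H]] := short_window_bound pp chi0 chi1 chiM chi_np qD q_gt0 q_le q1
  d3 dp T0 HT TCT CT1 erefl (lexx _) etad reta delta0 deltaE big1 big2 two sf U0 Up qU hV.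
pose Q (u v : nat) := ((u%:R : R, v%:R : R) \in C).
have S_le := @double_sum_bound R p chi f U V V0' (10 * U%:R * q (- (3 * delta))) Q alpha V0V.
rewrite /sum_integer_points lecR.
apply: (@le_trans _ _ (2 * V%:R * (10 * U%:R * q (- (3 * delta))))).
  apply: S_le.
  - by rewrite !mulr_ge0 ?ler0n // ltW.
  - move=> v0 Q' HQ'; rewrite [leRHS](_ : _ = 10 * U%:R * V0'%:R * q (- (3 * delta))); last by ring.
    exact: H.
  - by move=> u x y z xyz; exact: convex_in_plane_vertical.
  - by move=> u /halpha; rewrite -(lecR _ 1).
rewrite [leLHS](_ : _ = U%:R * V%:R * (20 * q (- (3 * delta)))); last by ring.
apply: ler_wpM2l; first by rewrite mulr_ge0 ?ler0n.
apply: (@le_trans _ _ (q (2 * delta) * q (- (3 * delta)))).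
  by apply: ler_wpM2r => //; exact: ltW.
by rewrite -qD; apply: q_le; rewrite -subr_ge0 (_ : _ - _ = 0) //; ring.
Qed.
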